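(* In the game semantics of safe $\lambda$-terms, pointers emanating from P-moves are unnecessary: if $\Gamma\vdash_{\sf s}M:T$ is derivable in the safe lambda calculus, then for every play $s\in[\![\Gamma\vdash M:T]\!]$ the pointers from P-moves of $s$ are uniquely recoverable from the underlying sequence of moves of $s$ together with the pointers from the O-moves of $s$ (i.e. two plays of $[\![\Gamma\vdash M:T]\!]$ with the same underlying sequence of moves and the same pointers from O-moves are equal).
   Context: Simple types are generated by $A ::= o \mid A \to A$ ($\to$ associates to the right); $(A_1,\ldots,A_n,B)$ abbreviates $A_1\to\cdots\to A_n\to B$. Orders: $\mathrm{ord}(o)=0$, $\mathrm{ord}(A\to B)=\max(\mathrm{ord}(A)+1,\mathrm{ord}(B))$. Terms are Church-style simply-typed terms built from typed variables, without constants. The order of a term or variable is the order of its type. Safe lambda calculus. Judgements $\Gamma\vdash_{\sf s} M:A$ and $\Gamma\vdash_{\sf asa} M:A$ are defined by mutual induction. ''$c\le \mathrm{ord}\,\Gamma$'' means $c\le \mathrm{ord}(y)$ for every $y\in\Gamma$. (var) $x:A\vdash_{\sf s}x:A$. (wk) from $\Gamma\vdash_{\sf s}M:A$ infer $\Delta\vdash_{\sf s}M:A$ if $\Gamma\subset\Delta$. ($\delta$) from $\Gamma\vdash_{\sf s}M:A$ infer $\Gamma\vdash_{\sf asa}M:A$. (app$_{as}$) from $\Gamma\vdash_{\sf asa}M:A\to B$ and $\Gamma\vdash_{\sf s}N:A$ infer $\Gamma\vdash_{\sf asa}MN:B$. (app) from $\Gamma\vdash_{\sf asa}M:A\to B$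 and $\Gamma\vdash_{\sf s}N:A$ infer $\Gamma\vdash_{\sf s}MN:B$, provided $\mathrm{ord}(B)\le\mathrm{ord}\,\Gamma$. (abs) from $\Gamma,x_1:A_1,\ldots,x_n:A_n\vdash_{\sf asa}M:B$ infer $\Gamma\vdash_{\sf s}\lambda x_1^{A_1}\ldots x_n^{A_n}.M:(A_1,\ldots,A_n,B)$, provided $\mathrm{ord}(A_1,\ldots,A_n,B)\le\mathrm{ord}\,\Gamma$. Game semantics (standard Hyland–Ong well-bracketed innocent game model). Fix a nonempty set $\mathcal D$ of values of type $o$. The arena of $o$ has one initial O-question enabling an answer $v$ for each $v\in\mathcal D$; the arena of $(A_1,\ldots,A_n,o)$ has one initial O-question $q$, enabling answers $v\in\mathcal D$ and the initial moves of copies of the arenas of $A_1,\ldots,A_n$ with O/P polarity reversed. $[\![x_1:A_1,\ldots,x_p:A_p\vdash M:T]\!]$ is the usual innocent strategy denoting $M$, on the arena of $(A_1,\ldots,A_p,T)$. A justified sequence is an alternating sequence of O- and P-moves, where each move except the opening (initial) one has a pointer to an earlier occurrence of a move enabling it; a play is a justified sequence satisfying Visibility and Well-Bracketing; a strategy is a prefix-closed set of plays. *)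

(* Defs.v *)
From mathcomp Require Import all_boot.

Set Implicit Arguments.
Unset Strict Implicit.
Unset Printing Implicit Defensive.

(** * Simple types and terms *)

Inductive ty : Type := Base | Arr of ty & ty.

Fixpoint ord (A : ty) : nat :=
  if A is Arr A1 A2 then maxn (ord A1).+1 (ord A2) else 0.

(* [arrs [:: A1; ...; An] B] is the type (A1, ..., An, B). *)
Definition arrs (As : seq ty) (B : ty) : ty := foldr Arr B As.

(* De Bruijn contexts: the head is the most recently declared variable, so the
   context x1 : A1, ..., xp : Ap is [:: Ap; ...; A1]. *)
Definition ctx := seq ty.

(* [close G T] is the type (A1, ..., Ap, T) when G is x1 : A1, ..., xp : Ap. *)
Fixpoint close (G : ctx) (T : ty) : ty :=
  if G is A :: G' then close G' (Arr A T) else T.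

Inductive var : ctx -> ty -> Type :=
| vz G A : var (A :: G) A
| vs G A B : var G A -> var (B :: G) A.
Arguments vz {G A}.
Arguments vs {G A B} x.

(* Intrinsically typed Church-style terms, up to alpha-conversion. *)
Inductive tm : ctx -> ty -> Type :=
| Var G A : var G A -> tm G A
| App G A B : tm G (Arr A B) -> tm G A -> tm G B
| Lam G A B : tm (A :: G) B -> tm G (Arr A B).

Definition ren (G D : ctx) := forall A : ty, var G A -> var D A.

Definition ren_up G D (r : ren G D) (B : ty) : ren (B :: G) (B :: D) :=
  fun A x =>
    match x in var G' A0
      return (if G' is B' :: G0
              then (forall A1, var G0 A1 -> var D A1) -> var (B' :: D) A0
              else unit)
    with
    | vz _ _ => fun _ => vz
    | vs _ _ _ y => fun r' => vs (r' _ y)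
    end r.

Fixpoint rename G A (M : tm G A) : forall D, ren G D -> tm D A :=
  match M with
  | Var _ _ x => fun D r => Var (r _ x)
  | App _ _ _ M1 M2 => fun D r => App (rename M1 r) (rename M2 r)
  | Lam _ B _ M1 => fun D r => Lam (rename M1 (ren_up r (B := B)))
  end.

(* [catrev As G] is the context G, x1 : A1, ..., xn : An, and
   [lams As M] is the term \x1 ... xn. M. *)
Fixpoint lams (As : seq ty) (G : ctx) (B : ty) :
    tm (catrev As G) B -> tm G (arrs As B) :=
  match As with
  | [::] => fun M => M
  | A :: As' => fun M => Lam (@lams As' (A :: G) B M)
  end.

(** * The safe lambda calculus *)

(* c <= ord Gamma *)
Definition ord_le_ctx (c : nat) (G : ctx) : bool := all (fun A => c <= ord A) G.

(* Contexts are sets of distinct typed variables, so an inclusion of contexts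
   is an injective type-preserving renaming. *)
Inductive safe : forall G A, tm G A -> Prop :=
| safe_var A : safe (Var (vz : var [:: A] A))
| safe_wk G D A (M : tm G A) (r : ren G D) :
    (forall B, injective (r B)) -> safe M -> safe (rename M r)
| safe_app G A B (M : tm G (Arr A B)) (N : tm G A) :
    asa M -> safe N -> ord_le_ctx (ord B) G -> safe (App M N)
| safe_abs G As B (M : tm (catrev As G) B) :
    0 < size As -> asa M -> ord_le_ctx (ord (arrs As B)) G -> safe (lams M)
with asa : forall G A, tm G A -> Prop :=
| asa_safe G A (M : tm G A) : safe M -> asa M
| asa_app G A B (M : tm G (Arr A B)) (N : tm G A) :
    asa M -> safe N -> asa (App M N).

(** * Arenas *)

(* [isP m] tells P-moves from O-moves, [isQ m] questions from answers, and
   [enab m n] means that m enables n. *)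
Record arena := Arena {
  move : Type;
  isP : move -> bool;
  isQ : move -> bool;
  init : move -> bool;
  enab : move -> move -> bool
}.
Arguments isP {a}.
Arguments isQ {a}.
Arguments init {a}.
Arguments enab {a}.

(* The question is [None]; the answer v is [Some v]. *)
Definition base_arena (D : Type) : arena := {|
  move := option D;
  isP := fun m : option D => isSome m;
  isQ := fun m : option D => ~~ isSome m;
  init := fun m : option D => ~~ isSome m;
  enab := fun m n : option D => ~~ isSome m && isSome n
|}.

Definition unit_arena : arena := {|
  move := Empty_set;
  isP := fun _ => false;
  isQ := fun _ => false;
  init := fun _ => false;
  enab := fun _ _ => false
|}.

Definition prod_arena (X Y : arena) : arena := {|
  move := (move X + move Y)%type;
  isP := fun m => match m with inl x => isP x | inr y => isP y end;
  isQ := fun m => match m with inl x => isQ x | inr y => isQ y end;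
  init := fun m => match m with inl x => init x | inr y => init y end;
  enab := fun m n =>
    match m, n with
    | inl x, inl x' => enab x x'
    | inr y, inr y' => enab y y'
    | _, _ => false
    end
|}.

Definition arrow_arena (X Y : arena) : arena := {|
  move := (move X + move Y)%type;
  isP := fun m => match m with inl x => ~~ isP x | inr y => isP y end;
  isQ := fun m => match m with inl x => isQ x | inr y => isQ y end;
  init := fun m => if m is inr y then init y else false;
  enab := fun m n =>
    match m, n with
    | inl x, inl x' => enab x x'
    | inr y, inr y' => enab y y'
    | inr y, inl x => init y && init x
    | inl _, inr _ => false
    end
|}.

Fixpoint ty_arena (D : Type) (A : ty) : arena :=
  match A with
  | Base => base_arena D
  | Arr A1 A2 => arrow_arena (ty_arena D A1) (ty_arena D A2)
  end.

Fixpoint ctx_arena (D : Type) (G : ctx) : arena :=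
  match G with
  | [::] => unit_arena
  | A :: G' => prod_arena (ctx_arena D G') (ty_arena D A)
  end.

(** * Justified sequences and plays *)

(* A sequence of moves with pointers: [(m, Some j)] points to the occurrence at
   position j (counted from 0), [(m, None)] has no pointer. *)
Definition pseq (T : Type) := seq (T * option nat).

Section Plays.
Variable X : arena.
Implicit Type s : pseq (move X).

Definition well_pointed s : Prop :=
  forall i m p, onth s i = Some (m, p) ->
    match p with
    | None => i = 0 /\ init m
    | Some j => j < i /\ exists n q, onth s j = Some (n, q) /\ enab n m
    end.

Definition alternating s : Prop :=
  forall i m p n q, onth s i = Some (m, p) -> onth s i.+1 = Some (n, q) ->
    isP n = ~~ isP m.

Definition justified s : Prop := well_pointed s /\ alternating s.

(* [view b s n j]: position j lies in the P-view (b = true), resp. the O-view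
   (b = false), of the prefix of s of length n. *)
Inductive view (b : bool) s : nat -> nat -> Prop :=
| view_last k : k < size s -> view b s k.+1 k
| view_own k m p j :
    onth s k = Some (m, p) -> isP m = b -> view b s k j -> view b s k.+1 j
| view_other k m l j :
    onth s k = Some (m, Some l) -> isP m = ~~ b ->
    view b s l.+1 j -> view b s k.+1 j.

Definition visible s : Prop :=
  forall i m j, onth s i = Some (m, Some j) -> view (isP m) s i j.

(* Some answer occurring before position i points to position k. *)
Definition answered_before s (i k : nat) : Prop :=
  exists l m, l < i /\ onth s l = Some (m, Some k) /\ ~~ isQ m.

(* Position j is the last unanswered question before position i. *)
Definition pending s (i j : nat) : Prop :=
  [/\ j < i, exists m p, onth s j = Some (m, p) /\ isQ m,
      ~ answered_before s i j &
      forall k m p, j < k < i -> onth s k = Some (m, p) -> isQ m ->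
        answered_before s i k].

Definition well_bracketed s : Prop :=
  forall i m j, onth s i = Some (m, Some j) -> ~~ isQ m -> pending s i j.

Definition play s : Prop := [/\ justified s, visible s & well_bracketed s].

(* The underlying moves of s together with the pointers from the O-moves. *)
Definition erase_P s : pseq (move X) :=
  [seq (mp.1, if isP mp.1 then None else mp.2) | mp <- s].

End Plays.

Definition plays (X : arena) := pseq (move X) -> Prop.

(** * Restrictions of justified sequences *)

Definition relabel (S T : Type) (f : S -> T) (s : pseq S) : pseq T :=
  [seq (f mp.1, mp.2) | mp <- s].

(* Restriction: the occurrence of m at position i is kept, as y, when
   [f i m = Some y], and erased when [f i m = None].  The pointer of a kept
   occurrence is obtained by following pointers until a kept occurrence is
   reached.  At position i, [size tab = i], and [tab] maps each earlier position
   to the new position of the nearest kept occurrence along its pointers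
   (including itself); k is the number of occurrences kept so far. *)
Fixpoint restr_from (S T : Type) (f : nat -> S -> option T) (s : pseq S)
    (tab : seq (option nat)) (k : nat) : pseq T :=
  if s is (m, p) :: s' then
    let p' := obind (nth None tab) p in
    match f (size tab) m with
    | Some y => (y, p') :: restr_from f s' (rcons tab (Some k)) k.+1
    | None => restr_from f s' (rcons tab p') k
    end
  else [::].

Definition restr_pos (S T : Type) (f : nat -> S -> option T) (s : pseq S) :=
  restr_from f s [::] 0.

Definition restr (S T : Type) (f : S -> option T) (s : pseq S) : pseq T :=
  restr_pos (fun _ => f) s.

(* The sequence whose i-th item is the pointerless occurrence that hereditarily
   justifies position i. *)
Definition roots (S : Type) (s : pseq S) : seq nat :=
  foldl (fun rs mp =>
           rcons rs (if mp.2 is Some j then nth (size rs) rs j else size rs))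
        [::] s.

(* The thread of s hereditarily justified by its occurrence at position b. *)
Definition thread (S : Type) (b : nat) (s : pseq S) : pseq S :=
  restr_pos (fun i m => if onth (roots s) i == Some b then Some m else None) s.

(** * The cartesian closed structure *)

(* Copycat between the components Y of X selected by l and r. *)
Definition copycat (X Y : arena) (l r : move X -> option (move Y)) : plays X :=
  fun s =>
    [/\ play s,
        all (fun mp => isSome (l mp.1) || isSome (r mp.1)) s &
        forall n, ~~ odd n -> n <= size s ->
          restr l (take n s) = restr r (take n s)].

Section CCC.
Variables X Y Z : arena.

Definition on_XY (m : (move X + move Y) + move Z) : option (move X + move Y) :=
  if m is inl xy then Some xy else None.
Definition on_YZ (m : (move X + move Y) + move Z) : option (move Y + move Z) :=
  match m with
  | inl (inl _) => None
  | inl (inr y) => Some (inl y)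
  | inr z => Some (inr z)
  end.
Definition on_XZ (m : (move X + move Y) + move Z) : option (move X + move Z) :=
  match m with
  | inl (inl x) => Some (inl x)
  | inl (inr _) => None
  | inr z => Some (inr z)
  end.

(* Parallel composition plus hiding.  Interaction sequences are taken over the
   moves and the enabling relation of (X => Y) => Z, where an initial move of Z
   enables those of Y, which enable those of X; the polarities of that arena
   are irrelevant. *)
Definition interaction
    (sigma : plays (arrow_arena X Y)) (tau : plays (arrow_arena Y Z))
    (u : pseq (move (arrow_arena (arrow_arena X Y) Z))) : Prop :=
  [/\ well_pointed u,
      forall b m, onth (restr on_XY u) b = Some (m, None) ->
        sigma (thread b (restr on_XY u)),
      tau (restr on_YZ u) &
      @play (arrow_arena X Z) (restr on_XZ u)].

Definition comp
    (sigma : plays (arrow_arena X Y)) (tau : plays (arrow_arena Y Z)) :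
    plays (arrow_arena X Z) :=
  fun s => exists2 u, interaction sigma tau u & s = restr on_XZ u.

Definition pair_l (m : move X + move Y) : move X + (move Y + move Z) :=
  match m with inl x => inl x | inr y => inr (inl y) end.
Definition pair_r (m : move X + move Z) : move X + (move Y + move Z) :=
  match m with inl x => inl x | inr z => inr (inr z) end.

Definition pairing
    (sigma : plays (arrow_arena X Y)) (tau : plays (arrow_arena X Z)) :
    plays (arrow_arena X (prod_arena Y Z)) :=
  fun s => (exists2 t, sigma t & s = relabel pair_l t)
        \/ (exists2 t, tau t & s = relabel pair_r t).

Definition curry_move (m : (move X + move Y) + move Z) :
    move X + (move Y + move Z) :=
  match m with
  | inl (inl x) => inl x
  | inl (inr y) => inr (inl y)
  | inr z => inr (inr z)
  end.

Definition curry (sigma : plays (arrow_arena (prod_arena X Y) Z)) :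
    plays (arrow_arena X (arrow_arena Y Z)) :=
  fun s => exists2 t, sigma t & s = relabel curry_move t.

End CCC.

Section Eval.
Variables Y Z : arena.

Definition eval_l (m : ((move Y + move Z) + move Y) + move Z) :
    option (move Y + move Z) :=
  if m is inl (inl yz) then Some yz else None.
Definition eval_r (m : ((move Y + move Z) + move Y) + move Z) :
    option (move Y + move Z) :=
  match m with
  | inl (inl _) => None
  | inl (inr y) => Some (inl y)
  | inr z => Some (inr z)
  end.

Definition eval : plays (arrow_arena (prod_arena (arrow_arena Y Z) Y) Z) :=
  @copycat (arrow_arena (prod_arena (arrow_arena Y Z) Y) Z) (arrow_arena Y Z)
    eval_l eval_r.

End Eval.

(** * The denotation of terms *)

Section Denotation.
Variable D : Type.

(* Selects the moves of [ctx_arena D G] in the component of the variable x. *)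
Fixpoint var_move G A (x : var G A) :
    move (ctx_arena D G) -> option (move (ty_arena D A)) :=
  match x in var G A
    return move (ctx_arena D G) -> option (move (ty_arena D A)) with
  | vz _ _ => fun m => if m is inr a then Some a else None
  | vs _ _ _ y => fun m => if m is inl g then var_move y g else None
  end.

Definition proj G A (x : var G A) :
    plays (arrow_arena (ctx_arena D G) (ty_arena D A)) :=
  @copycat (arrow_arena (ctx_arena D G) (ty_arena D A)) (ty_arena D A)
    (fun m => if m is inl g then var_move x g else None)
    (fun m => if m is inr a then Some a else None).

Fixpoint den G A (M : tm G A) :
    plays (arrow_arena (ctx_arena D G) (ty_arena D A)) :=
  match M in tm G A
    return plays (arrow_arena (ctx_arena D G) (ty_arena D A)) with
  | Var _ _ x => proj x
  | App _ _ _ M1 M2 => comp (pairing (den M1) (den M2)) (@eval _ _)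
  | Lam _ _ _ M1 => curry (den M1)
  end.

(* The isomorphism from the arena A1 x ... x Ap => T to the arena of the type
   (A1, ..., Ap, T). *)
Fixpoint close_move (G : ctx) (T : ty) :
    move (ctx_arena D G) + move (ty_arena D T) ->
    move (ty_arena D (close G T)) :=
  match G return move (ctx_arena D G) + move (ty_arena D T) ->
                 move (ty_arena D (close G T)) with
  | [::] => fun m => match m with inl e => match e with end | inr t => t end
  | A :: G' => fun m => @close_move G' (Arr A T) (curry_move m)
  end.

Definition sem G T (M : tm G T) : plays (ty_arena D (close G T)) :=
  fun s => exists2 t, den M t & s = relabel (@close_move G T) t.

End Denotation.
Arguments den D {G A} M _.
Arguments sem D {G T} M _.

(* Main.v *)
(** Give an answer level 0 and a question the order of its type plus 1, so that
    enabling strictly decreases levels below the initial move.  Call a play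
    incremental if every P-move [m] pointing to [j] has at least the level of all
    O-moves after [j] in its P-view; [j] is then the last O-move of the P-view that
    enables [m], which determines the pointer.

    Incrementality is proved by induction on the term.  Copycat plays have it
    because a copied move points just before the justifier of the move it copies.
    For an application one traces the P-view of the composite back through the
    interaction: it refines the view of the player to move by inserting, under
    each move [a] made by the other player in the shared arena, a segment of that
    player's view ending at the justifier of [a], and by induction this segment
    only contains O-moves of level at most that of [a].  A move of a free variable
    of an argument escapes this bound, since its justifier lies beyond the whole
    thread of the argument; this is where safety is needed: it makes the variable's
    order at least the order of the argument. *)
Require Import Defs.
From mathcomp Require Import all_boot.
From mathcomp Require Import zify.

Set Implicit Arguments.
Unset Strict Implicit.
Unset Printing Implicit Defensive.

(* [roots] is also a name of fingraph. *)
Local Notation roots := Defs.roots.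

(** * Arenas and levels *)

Record arena_ok (X : arena) : Prop := ArenaOk {
  init_O : forall m : move X, init m -> isP m = false;
  enab_pol : forall m n : move X, enab m n -> isP n = ~~ isP m;
  enab_init : forall m n : move X, enab m n -> init n = false
}.

Lemma base_ok D : arena_ok (base_arena D).
Proof. by split=> [[]|[a|] [b|]|[a|] [b|]]. Qed.

Lemma unit_ok : arena_ok unit_arena.
Proof. by split=> [[]|[]|[]]. Qed.

Lemma prod_ok X Y : arena_ok X -> arena_ok Y -> arena_ok (prod_arena X Y).
Proof.
move=> [iX pX eX] [iY pY eY]; split=> [[x|y]|[x|y] [x'|y']|[x|y] [x'|y']] //=;
  by [apply: iX | apply: iY | apply: pX | apply: pY | apply: eX | apply: eY].
Qed.

Lemma arrow_ok X Y : arena_ok X -> arena_ok Y -> arena_ok (arrow_arena X Y).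
Proof.
move=> [iX pX eX] [iY pY eY]; split=> [[x|y]|[x|y] [x'|y']|[x|y] [x'|y']] //=.
- exact: iY.
- by move/pX->.
- by case/andP=> /iY-> /iX->.
- exact: pY.
- exact: eY.
Qed.

Lemma ty_ok D A : arena_ok (ty_arena D A).
Proof. by elim: A => [|A ? B ?] /=; [apply: base_ok | apply: arrow_ok]. Qed.

Lemma ctx_ok D G : arena_ok (ctx_arena D G).
Proof. by elim: G => [|A G ?] /=; [apply: unit_ok | apply: prod_ok => //; apply: ty_ok]. Qed.

(** The opening question of [A2] is also that of [Arr A1 A2], so its level is reset to that of the
    whole type; all other moves keep the level of their component. *)
Fixpoint lev (D : Type) (A : ty) : move (ty_arena D A) -> nat :=
  match A return move (ty_arena D A) -> nat with
  | Base => fun m => if m is Some _ then 0 else 1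
  | Arr A1 A2 => fun m =>
      match m with
      | inl a => lev a
      | inr b => if init b then (ord (Arr A1 A2)).+1 else lev b
      end
  end.

Fixpoint clev (D : Type) (G : ctx) : move (ctx_arena D G) -> nat :=
  match G return move (ctx_arena D G) -> nat with
  | [::] => fun _ => 0
  | A :: G' => fun m => match m with inl g => clev g | inr a => lev a end
  end.

Definition sum_lev (S T : Type) (f : S -> nat) (g : T -> nat) (m : S + T) :=
  match m with inl x => f x | inr y => g y end.

Lemma lev_init D A (m : move (ty_arena D A)) : init m -> lev m = (ord A).+1.
Proof. by case: A m => [[]|A B [a|b]] //= ->. Qed.

Lemma lev_enab D A (m n : move (ty_arena D A)) : enab m n -> lev n < lev m.
Proof.
elim: A m n => [[a|] [b|] //|A IHA B IHB [a|b] [a'|b']] //=.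
- exact: IHA.
- by case/andP=> Ib Ia; rewrite Ib (lev_init Ia) ltnS leq_max leqnn.
- move=> E; rewrite (enab_init (ty_ok D B) E); case: ifP => [Ib|_]; last exact: IHB.
  by have := IHB _ _ E; rewrite (lev_init Ib); lia.
Qed.

Lemma clev_enab D G (m n : move (ctx_arena D G)) : enab m n -> clev n < clev m.
Proof.
elim: G m n => [[]|A G IH [g|a] [g'|a']] //=; [exact: IH|exact: lev_enab].
Qed.

(** * Views *)

Lemma onth_lt T (s : seq T) i x : onth s i = Some x -> i < size s.
Proof. by move=> E; rewrite -onthTE E. Qed.

Lemma onth_ex T (s : seq T) i : i < size s -> exists x, onth s i = Some x.
Proof. by rewrite -onthTE; case: (onth s i) => // x _; exists x. Qed.

Definition incr (X : arena) (lv : move X -> nat) (s : pseq (move X)) : Prop :=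
  forall i m j k n q, onth s i = Some (m, Some j) -> isP m ->
    view true s i k -> j < k -> onth s k = Some (n, q) -> ~~ isP n ->
    lv n <= lv m.

Section Views.
Variable X : arena.
Hypothesis okX : arena_ok X.
Implicit Types (s t : pseq (move X)).

Lemma view_lt b s n k : well_pointed s -> view b s n k -> k < n.
Proof.
move=> W; elim=> {n k} // [n m p k _ _ _|n m l k E _ _ IH]; first by lia.
by have [+ _] := W _ _ _ E; lia.
Qed.

Lemma ptr0 s m p : well_pointed s -> onth s 0 = Some (m, p) -> p = None.
Proof. by move=> W E; have := W _ _ _ E; case: p E => // j _ []. Qed.

Lemma ptrS s i m p : well_pointed s -> onth s i.+1 = Some (m, p) ->
  exists2 j, p = Some j & j <= i.
Proof.
move=> W E; have := W _ _ _ E; case: p E => [j _ [lt _]|_ [] //].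
by exists j.
Qed.

Lemma init_pos s i m p : well_pointed s -> onth s i = Some (m, p) ->
  init m = (i == 0).
Proof.
move=> W E; have := W _ _ _ E; case: p E => [j _|_ [-> ->] //].
by case=> lt [n [q [_ /(enab_init okX) ->]]]; case: i lt.
Qed.

Lemma parity s i m p : justified s -> onth s i = Some (m, p) -> isP m = odd i.
Proof.
case=> W A; elim: i m p => [|i IH] m p E /=.
  by apply: (init_O okX); rewrite (init_pos W E).
have [[n q] E'] : exists x, onth s i = Some x.
  by apply: onth_ex; have := onth_lt E; lia.
by rewrite (A _ _ _ _ _ E' E) (IH _ _ E').
Qed.

Lemma view_inv b s n m p k : onth s n = Some (m, p) -> view b s n.+1 k ->
  [\/ k = n, isP m = b /\ view b s n k |
      exists l, [/\ p = Some l, isP m = ~~ b & view b s l.+1 k]].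
Proof.
move=> E V; inversion V as [|? m' p' ? E' P V'|? m' l ? E' P V']; subst.
- by constructor 1.
- by move: E'; rewrite E => -[??]; subst; constructor 2.
- by move: E'; rewrite E => -[??]; subst; constructor 3; exists l.
Qed.

Lemma onth_take_eq (T : Type) (s t : seq T) n i : take n s = take n t -> i < n ->
  onth s i = onth t i.
Proof.
move=> E lt; have H : forall r : seq T, onth (take n r) i = onth r i.
  move=> r; elim: r n i lt {E} => [|x r IH] [|n] [|i] //= lt; exact: IH.
by rewrite -H E H.
Qed.

Lemma view_take b s t n k : n <= size s -> n <= size t ->
  well_pointed s -> take n s = take n t -> view b s n k -> view b t n k.
Proof.
move=> ls lt W E V; elim: V ls lt E => {n k} [k lt0|k m p j Ek P _ IH|k m l j Ek P _ IH] ls lt E.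
- exact: view_last.
- have E' : onth t k = Some (m, p) by rewrite -(onth_take_eq E).
  apply: (view_own E' P); apply: IH; try lia.
  by rewrite -(@take_takel _ k k.+1) // E take_takel.
- have E' : onth t k = Some (m, Some l) by rewrite -(onth_take_eq E).
  have [ll _] := W _ _ _ Ek.
  apply: (view_other E' P); apply: IH; try lia.
  by rewrite -(@take_takel _ l.+1 k.+1) ?E ?take_takel //; lia.
Qed.

(** * Incrementality determines the pointers of P-moves *)

Variable lv : move X -> nat.
(** The opening move is exempt: in the arena of a term in context its level comes from the result
    type, yet it enables variables of arbitrary order. *)
Hypothesis lv_enab :
  forall m n : move X, enab m n -> ~~ init m -> lv n < lv m.

(** Suppose [j < j']. By visibility of [t], [j'] lies in the P-view at [i], which depends only on
    the common prefix and so is shared with [s]. Being an O-move after [j], it has at most the level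
    of [m] by incrementality; but it enables [m] and, being positive, is not the opening move, so
    its level is strictly larger. *)
Lemma incr_ptr_le s t i m j j' : play s -> play t -> incr lv s ->
  take i s = take i t -> onth s i = Some (m, Some j) ->
  onth t i = Some (m, Some j') -> isP m -> j' <= j.
Proof.
move=> [[Ws As] _ _] [[Wt At] Vt _] I E Es Et P.
rewrite leqNgt; apply/negP=> lt.
have [li [n [q [En en]]]] := Wt _ _ _ Et.
have V := Vt _ _ _ Et; rewrite P in V.
have Vs : view true s i j'.
  apply: view_take V => //; [exact: ltnW (onth_lt Et)|exact: ltnW (onth_lt Es)].
have En' : onth s j' = Some (n, q) by rewrite (onth_take_eq E).
have Pn : ~~ isP n by rewrite -(enab_pol okX en).
have := I _ _ _ _ _ _ Es P Vs lt En' Pn.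
have := lv_enab en; rewrite (init_pos Ws En') => /(_ _).
by case: j' lt {En' Vs V En Et li} => // j' _ /(_ isT); lia.
Qed.

Lemma incr_inj s t : play s -> play t -> incr lv s -> incr lv t ->
  erase_P s = erase_P t -> s = t.
Proof.
move=> ps pt Is It E.
have sz : size s = size t by have := congr1 size E; rewrite !size_map.
suff H n : take n s = take n t by rewrite -(take_size s) H sz take_size.
elim: n => [|n IH]; first by rewrite !take0.
have [ge|lt] := leqP (size s) n.
  by rewrite !take_oversize -?sz // ?(leqW ge) // -(take_oversize ge) IH take_oversize -?sz.
have [[m p] Es] := onth_ex lt.
have lt' := lt; rewrite sz in lt'; have [[m' p'] Et] := onth_ex lt'.
have : onth (erase_P s) n = onth (erase_P t) n by rewrite E.
rewrite !onth_map Es Et /= => -[Em Ep]; subst m'.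
suff Epp : p = p'.
  rewrite (take_nth (m, p)) // (take_nth (m, p) lt') IH; congr rcons.
  by rewrite -(odflt_onth (m,p) s n) -(odflt_onth (m,p) t n) Es Et Epp.
case: ifP Ep => [P _|//].
have [[[Ws _] _ _] [[Wt _] _ _]] := (ps, pt).
case: n IH lt lt' Es Et => [|n] IH lt lt' Es Et.
  by rewrite (ptr0 Ws Es) (ptr0 Wt Et).
have [j Ej _] := ptrS Ws Es; have [j' Ej' _] := ptrS Wt Et; subst p p'.
congr Some; apply/eqP; rewrite eqn_leq.
by rewrite (incr_ptr_le pt ps It (esym IH) Et Es P) (incr_ptr_le ps pt Is IH Es Et P).
Qed.

End Views.

(** * Relabelling *)

Lemma relabel_inv S T (h : S -> T) (s : pseq S) i m p :
  onth (relabel h s) i = Some (m, p) -> exists2 m', onth s i = Some (m', p) & m = h m'.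
Proof. by rewrite onth_map; case: (onth s i) => //= -[m' p'] [<- <-]; exists m'. Qed.

Lemma relabel_fwd S T (h : S -> T) (s : pseq S) i m p :
  onth s i = Some (m, p) -> onth (relabel h s) i = Some (h m, p).
Proof. by rewrite onth_map => ->. Qed.

Section Relabel.
Variables (X Y : arena) (h : move X -> move Y).
Hypotheses (hP : forall m, isP (h m) = isP m) (hQ : forall m, isQ (h m) = isQ m)
  (hI : forall m, init (h m) = init m)
  (hE : forall m n, enab (h m) (h n) = enab m n).
Variable s : pseq (move X).

Lemma view_relabel b n k : view b (relabel h s) n k <-> view b s n k.
Proof.
split; elim=> {n k} [k|k m p j E P _ IH|k m l j E P _ IH].
- by rewrite size_map; apply: view_last.
- by have [m' E' Em] := relabel_inv E; apply: (view_own E') => //; rewrite -P Em hP.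
- by have [m' E' Em] := relabel_inv E; apply: (view_other E') => //; rewrite -P Em hP.
- by move=> lt; apply: view_last; rewrite size_map.
- by apply: (view_own (relabel_fwd _ E)); rewrite ?hP.
- by apply: (view_other (relabel_fwd _ E)); rewrite ?hP.
Qed.

Lemma answered_relabel i k : answered_before (relabel h s) i k <-> answered_before s i k.
Proof.
split=> -[l [m [lt [E Q]]]].
  by have [m' E' Em] := relabel_inv E; exists l, m'; rewrite -hQ -Em.
by exists l, (h m); rewrite hQ (relabel_fwd _ E).
Qed.

Lemma play_relabel : play s -> play (relabel h s).
Proof.
move=> [[W A] V B]; split; [split|..].
- move=> i m p Em; have [m' E ->] := relabel_inv Em; have := W _ _ _ E.
  case: p {Em} E => [j _ [lt [n [q [En e]]]]|_ [-> ?]]; last by rewrite hI.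
  by split=> //; exists (h n), q; rewrite hE (relabel_fwd _ En).
- move=> i m p n q Em En; have [m' E ->] := relabel_inv Em.
  have [n' E' ->] := relabel_inv En.
  by rewrite !hP; apply: A E E'.
- move=> i m j Em; have [m' E ->] := relabel_inv Em; rewrite hP.
  by apply/view_relabel; apply: V E.
- move=> i m j Em; have [m' E ->] := relabel_inv Em; rewrite hQ => nQ.
  have [lt [n [q [En Q]]] na al] := B _ _ _ E nQ; split=> //.
  + by exists (h n), q; rewrite hQ (relabel_fwd _ En).
  + by move/answered_relabel.
  + move=> k mk pk lk Emk; have [mk' Ek ->] := relabel_inv Emk; rewrite hQ => Qk.
    by apply/answered_relabel; apply: al Qk => //; eauto.
Qed.

(** Levels need only agree off the opening move because currying may change the level of that move.
    Neither compared move is the opening one: [m] is a P-move and [n] lies after [j]. *)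
Lemma incr_relabel (lX : move X -> nat) (lY : move Y -> nat) :
  arena_ok X -> (forall m, ~~ init m -> lY (h m) = lX m) ->
  play s -> incr lX s -> incr lY (relabel h s).
Proof.
move=> okX hL [[W _] _ _] I i m j k n q Em + /view_relabel V lt En.
have [m' E ->] := relabel_inv Em; have [n' E' ->] := relabel_inv En.
rewrite !hP => P O.
have ni : ~~ init n' by rewrite (init_pos okX W E'); lia.
have nm : ~~ init m' by apply: contraL P => /(init_O okX)->.
by rewrite !hL //; apply: I E _ V _ E' _.
Qed.

End Relabel.

(** * Restrictions *)

Definition cnt (K : pred nat) (n : nat) : nat := count K (iota 0 n).

Implicit Types K : pred nat.

Lemma cntS K n : cnt K n.+1 = cnt K n + K n.
Proof. by rewrite /cnt -addn1 iotaD count_cat /= addn0. Qed.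

Lemma cnt_mono K m n : m <= n -> cnt K m <= cnt K n.
Proof. by move=> le; rewrite /cnt -(subnKC le) iotaD count_cat leq_addr. Qed.

Lemma cnt_lt K m n : m < n -> K m -> cnt K m < cnt K n.
Proof. by move=> lt Km; have := cnt_mono K lt; rewrite cntS Km; lia. Qed.

Lemma cnt_inj K m n : K m -> K n -> cnt K m = cnt K n -> m = n.
Proof.
by move=> Km Kn E; case: (ltngtP m n) => // lt;
  [have := cnt_lt lt Km | have := cnt_lt lt Kn]; lia.
Qed.

Lemma cnt_surj K n r : r < cnt K n -> exists i, [/\ i < n, K i & cnt K i = r].
Proof.
elim: n => [|n IH]; first by rewrite /cnt.
rewrite cntS; case: (ltnP r (cnt K n)) => [lt _|ge].
  by have [i [? ? ?]] := IH lt; exists i; split=> //; lia.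
by case Kn: (K n) => lt; [exists n; split=> //; lia|lia].
Qed.

Lemma eq_cnt K K' n : (forall i, i < n -> K i = K' i) -> cnt K n = cnt K' n.
Proof. by move=> E; apply: eq_in_count => i; rewrite mem_iota /= add0n; apply: E. Qed.

(** Translates positions through two successive restrictions, as for a thread of a restriction. *)
Lemma cnt_comp K K' n :
  cnt (fun i => K i && K' (cnt K i)) n = cnt K' (cnt K n).
Proof.
elim: n => [|n IH] //; rewrite !cntS IH; case: (K n) => /=; last by rewrite !addn0.
by rewrite addn1 cntS.
Qed.

Section Restr.
Variables (S T : Type) (f : nat -> S -> option T).

Definition kept (u : pseq S) : pred nat :=
  fun i => if onth u i is Some (m, _) then isSome (f i m) else false.

(* How the pointer [p] of a kept occurrence at position [i] is translated; only
   the cases where the target is kept or pointerless are recorded. *)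
Definition restr_ptr (u : pseq S) (i : nat) (p p' : option nat) : Prop :=
  (forall x, p' = Some x -> x < cnt (kept u) i) /\
  match p with
  | None => p' = None
  | Some j => j < i ->
      (kept u j -> p' = Some (cnt (kept u) j)) /\
      (~~ kept u j -> forall n, onth u j = Some (n, None) -> p' = None)
  end.

(** Loop invariant of [restr_from]: what [tab] and [k] record once [size tab] items of [u] have been
    read. *)
Let tab_ok u (tab : seq (option nat)) k :=
  k = cnt (kept u) (size tab) /\
  forall j, j < size tab ->
    [/\ forall x, nth None tab j = Some x -> x < k,
        kept u j -> nth None tab j = Some (cnt (kept u) j) &
        ~~ kept u j -> forall n, onth u j = Some (n, None) -> nth None tab j = None].

Let tab_ptr u tab k p : tab_ok u tab k ->
  restr_ptr u (size tab) p (obind (nth None tab) p).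
Proof.
case=> -> H; split.
  case: p => [j|] //= x E; case: (ltnP j (size tab)) => [lt|ge].
    by have [/(_ _ E)] := H _ lt.
  by rewrite nth_default in E.
by case: p => [j|] //= /H[].
Qed.

Let restr_from_spec s tab k pre : size tab = size pre -> tab_ok (pre ++ s) tab k ->
  size (restr_from f s tab k) + k = cnt (kept (pre ++ s)) (size (pre ++ s)) /\
  forall i m p y, size pre <= i -> onth (pre ++ s) i = Some (m, p) -> f i m = Some y ->
    k <= cnt (kept (pre ++ s)) i /\
    exists2 p', onth (restr_from f s tab k) (cnt (kept (pre ++ s)) i - k) = Some (y, p')
      & restr_ptr (pre ++ s) i p p'.
Proof.
elim: s tab k pre => [|[m p] s IH] tab k pre Es ok /=.
  split; first by rewrite cats0 -Es; case: ok; rewrite cats0.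
  by move=> i m p y ge E; have := onth_lt E; rewrite cats0; lia.
set u := pre ++ _ in ok *; have Eu : u = rcons pre (m, p) ++ s by rewrite cat_rcons.
have Em : onth u (size pre) = Some (m, p).
  by rewrite /u onth_cat ltnn subnn.
have Pok := tab_ptr p ok; set p' := obind _ p in Pok *.
have kE : kept u (size pre) = isSome (f (size tab) m) by rewrite /kept Em Es.
have [Ek tk] := ok.
have tk' k' q : (k <= k') -> (forall x, q = Some x -> x < k') ->
    (kept u (size pre) -> q = Some k) -> 
    (~~ kept u (size pre) -> p = None -> q = None) ->
    k' = cnt (kept u) (size (rcons tab q)) -> tab_ok u (rcons tab q) k'.
  move=> le lq Kq Nq E; split=> // j; rewrite size_rcons ltnS leq_eqVlt nth_rcons.
  case/predU1P=> [->|lt]; last first.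
    by rewrite lt; have [a b c] := tk _ lt; split=> // x /a; lia.
  rewrite ltnn eqxx; split=> //; rewrite Es => Kj.
    by rewrite Kq // Ek Es.
  by move=> n; rewrite Em => -[_ pN]; apply: Nq.
case Ef: (f (size tab) m) kE => [y|] /= kE.
- have tk1 : tab_ok u (rcons tab (Some k)) k.+1.
    apply: tk' => //.
    + by move=> x [->].
    + by rewrite kE.
    + by rewrite size_rcons cntS Es kE Ek Es addn1.
  have sz : size (rcons tab (Some k)) = size (rcons pre (m, p)) by rewrite !size_rcons Es.
  have := IH _ _ _ sz; rewrite -Eu => /(_ _ tk1)[IHs IHp].
  split; first by rewrite addSnnS.
  move=> i n q z; rewrite leq_eqVlt => /predU1P[<-|lt] Ei Eq.
    rewrite Ek Es; split=> //; rewrite subnn; exists p'.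
      by move: Ei Eq; rewrite Em => -[<- _]; rewrite -Es Ef => -[->].
    by move: Ei; rewrite Em => -[_ <-]; rewrite -Es.
  have [|le [q' E R]] := IHp _ _ _ _ _ Ei Eq; first by rewrite size_rcons.
  split; first by lia.
  by exists q' => //; rewrite -[cnt _ i - k]prednK ?subnS // in E *; lia.
- have tk1 : tab_ok u (rcons tab p') k.
    apply: tk' => //.
    + by move=> x /(proj1 Pok); rewrite Ek.
    + by rewrite kE.
    + by rewrite /p' => _ ->.
    + by rewrite size_rcons cntS Es kE Ek Es addn0.
  have sz : size (rcons tab p') = size (rcons pre (m, p)) by rewrite !size_rcons Es.
  have := IH _ _ _ sz; rewrite -Eu => /(_ _ tk1)[IHs IHp].
  split; first by [].
  move=> i n q z; rewrite leq_eqVlt => /predU1P[<-|lt] Ei Eq.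
    by move: Ei Eq; rewrite Em => -[<- _]; rewrite -Es Ef.
  by apply: IHp Ei Eq; rewrite size_rcons.
Qed.

Lemma size_restr u : size (restr_pos f u) = cnt (kept u) (size u).
Proof.
by have [] := @restr_from_spec u [::] 0 [::] erefl; rewrite ?addn0 //; split.
Qed.

Lemma onth_restr u i m p y : onth u i = Some (m, p) -> f i m = Some y ->
  exists2 p', onth (restr_pos f u) (cnt (kept u) i) = Some (y, p') & restr_ptr u i p p'.
Proof.
move=> E Ef; have [|_ H] := @restr_from_spec u [::] 0 [::] erefl; first by split.
by have [_] := H _ _ _ _ (leq0n i) E Ef; rewrite subn0.
Qed.

Lemma kept_lt u i : kept u i -> i < size u.
Proof. by rewrite /kept; case E: (onth u i) => // _; apply: onth_lt E. Qed.

Lemma restr_surj u r y p' : onth (restr_pos f u) r = Some (y, p') ->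
  exists i m p, [/\ onth u i = Some (m, p), f i m = Some y, cnt (kept u) i = r &
                    restr_ptr u i p p'].
Proof.
move=> E; have := onth_lt E; rewrite size_restr => /cnt_surj[i [_ K Ei]].
move: K; rewrite /kept; case Em: (onth u i) => [[m p]|] //.
case Ef: (f i m) => [z|] // _; exists i, m, p.
by have [q' E' R] := onth_restr Em Ef; move: E'; rewrite Ei E => -[-> ->]; split.
Qed.

End Restr.

(** * Hereditary justifiers *)

Section Roots.
Variable S : Type.
Implicit Type s : pseq S.

Lemma roots_rcons s mp : roots (rcons s mp) =
  rcons (roots s) (if mp.2 is Some j then nth (size (roots s)) (roots s) j
                   else size (roots s)).
Proof. by rewrite /roots foldl_rcons. Qed.

Lemma size_roots s : size (roots s) = size s.
Proof. by elim/last_ind: s => // s x IH; rewrite roots_rcons !size_rcons IH. Qed.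

Lemma nth_roots s r m p : onth s r = Some (m, p) ->
  (forall j, p = Some j -> j < r) ->
  nth 0 (roots s) r = if p is Some j then nth 0 (roots s) j else r.
Proof.
elim/last_ind: s r m p => [|s x IH] r m p; first by rewrite onth0n.
rewrite -cats1 onth_cat cats1 roots_rcons => E lt.
have lnth j : j < size s -> forall z, nth 0 (rcons (roots s) z) j = nth 0 (roots s) j.
  by move=> lj z; rewrite nth_rcons size_roots lj.
case: (ltnP r (size s)) E => [lr|ge] E.
  rewrite lnth // (IH _ _ _ E lt); case: p E lt => // j _ /(_ j erefl) lj.
  by rewrite lnth //; lia.
have Er : r = size s.
  by have := onth_lt E => /=; lia.
rewrite nth_rcons size_roots Er ltnn eqxx.
move: E; rewrite Er subnn => -[Ex]; rewrite Ex /=; case: p lt {Ex} => // j /(_ j erefl) lj.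
by rewrite lnth -?Er //; apply: set_nth_default; rewrite size_roots -Er.
Qed.

Lemma onth_roots s r b : r < size s -> (onth (roots s) r == Some b) = (nth 0 (roots s) r == b).
Proof. move=> lt; have [x E] := onth_ex (s := roots s) (i := r) ltac:(by rewrite size_roots).
by rewrite E (onth_nth 0 _ _ _ E). Qed.

Lemma root_pointerless s r : r < size s ->
  (forall i m j, onth s i = Some (m, Some j) -> j < i) ->
  exists m, onth s (nth 0 (roots s) r) = Some (m, None).
Proof.
move=> + W; elim/ltn_ind: r => r IH lt.
have [[m p] E] := onth_ex lt.
rewrite (nth_roots E) => [|j Ej]; last by apply: (W _ m); rewrite E Ej.
case: p E => [j|] E; last by exists m.
by have lj := W _ _ _ E; apply: IH => //; lia.
Qed.

End Roots.

(** * Copycat strategies *)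

Section Copycat.
Variables (X Y : arena) (l r : move X -> option (move Y)).
Hypothesis okX : arena_ok X.
Hypothesis disj : forall m, l m -> r m -> False.
Hypothesis enab_side : forall m n, enab m n -> l m = l n :> bool \/ init m.
Variable s : pseq (move X).
Hypothesis cs : copycat l r s.

Let sel (b : bool) := if b then l else r.
Let side i := if onth s i is Some (m, _) then isSome (l m) else false.
Let knt b n := cnt (kept (fun _ => sel b) s) n.

Let keptE b i m p : onth s i = Some (m, p) ->
  kept (fun _ => sel b) s i = (b == side i).
Proof.
move=> E; rewrite /kept /side E; case: cs => _ /(all_nthP (m, p))/(_ i (onth_lt E)) /=.
rewrite (onth_nth (m, p) _ _ _ E) /= => A _.
case: b A => /=; first by case: (l m).
by case El: (l m) (@disj m) => [?|] //=; case: (r m) => // ? /(_ isT isT).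
Qed.

Let kntS b n : knt b n.+1 = knt b n + kept (fun _ => sel b) s n.
Proof. exact: cntS. Qed.

Let knt_even n : ~~ odd n -> n <= size s -> knt true n = knt false n.
Proof.
move=> ev le; have [_ _ /(_ n ev le) /(congr1 size)] := cs.
rewrite /restr !size_restr size_take_min (minn_idPl le).
have Ek b : cnt (kept (fun _ => sel b) (take n s)) n = knt b n.
  apply: eq_cnt => i lt; rewrite /kept.
  by rewrite (@onth_take_eq _ _ s n) // take_takel.
by have := Ek true; have := Ek false; rewrite /= => -> ->.
Qed.

(** The two restrictions have equal lengths both before [i] and after [i.+1], so of the two moves in
    between exactly one lies on each side. *)
Let side_alt i m p : ~~ odd i -> onth s i.+1 = Some (m, p) ->
  side i.+1 = ~~ side i.
Proof.
move=> ev E; have lt := onth_lt E.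
have [[n q] E'] : exists x, onth s i = Some x by apply: onth_ex; lia.
have := @knt_even i.+2; rewrite /= negbK ev => /(_ isT lt).
rewrite !kntS (@knt_even i) //; last by lia.
rewrite !(keptE _ E) !(keptE _ E').
by case: (side i) (side i.+1) => [] [] //; lia.
Qed.

(** At even lengths the two restrictions are one sequence, so moves of either side can be located in
    [restr l] and compared there. *)
Let onth_even b n i m p y : ~~ odd n -> n <= size s -> i < n -> onth s i = Some (m, p) ->
  sel b m = Some y ->
  exists2 p', onth (restr l (take n s)) (knt b i) = Some (y, p') &
    restr_ptr (fun _ => sel b) s i p p'.
Proof.
move=> ev le lt E Ey.
have Et j : j < n -> onth (take n s) j = onth s j.
  by move=> ltj; rewrite (@onth_take_eq _ _ s n) // take_takel.
have [|p' E' R] := @onth_restr _ _ (fun _ => sel b) (take n s) i m p y _ Ey.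
  by rewrite Et.
have Ekp j : j < n -> kept (fun _ => sel b) (take n s) j = kept (fun _ => sel b) s j.
  by move=> ltj; rewrite /kept Et.
have Ek j : j <= n -> cnt (kept (fun _ => sel b) (take n s)) j = knt b j.
  by move=> lej; apply: eq_cnt => k ltk; apply: Ekp; lia.
exists p'.
  rewrite -Ek ?(ltnW lt) //.
  by case: b Ey E' {Ek Ekp R} => //= _ E'; have [_ _ ->] := cs.
have lei := ltnW lt; move: R; rewrite /restr_ptr Ek // => -[? R]; split=> //.
case: p R {E E'} => // j R ltj; have := R ltj.
by rewrite Ekp ?Et ?Ek //; lia.
Qed.

(* P plays the copy of the preceding O-move; equality of the two restrictions forces
   its pointer to the copy of that move's justifier, which is one step earlier. *)
Lemma copycatP i m p : odd i.+1 -> 0 < i -> onth s i.+1 = Some (m, p) ->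
  exists n j y, [/\ p = Some j, onth s i = Some (n, Some j.+1) &
    (l m = Some y /\ r n = Some y) \/ (r m = Some y /\ l n = Some y)].
Proof.
move=> od pos E; have lt := onth_lt E; have ev : ~~ odd i := od.
have [[[W A] _ _] _ _] := cs.
have [[n q] E'] : exists x, onth s i = Some x by apply: onth_ex; lia.
have [j Ep lej] := ptrS W E; subst p.
have Par := parity okX (conj W A).
have alt := side_alt ev E.
have [k Eq ltk] : exists2 k, q = Some k & k < i.
  by case: i pos E' {E od lt ev alt lej} => // i _ /(ptrS W)[k -> le]; exists k.
subst q; have [_ [n' [q' [Ek en]]]] := W _ _ _ E'.
(* The justifier of an O-move is a P-move, hence at an odd position and preceded by the O-move that
   it copies. *)
have odk : odd k.
  by rewrite -(Par _ _ _ Ek); have := enab_pol okX en; rewrite (Par _ _ _ E'); case: isP; lia.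
case: k odk ltk E' Ek => // k evk ltk E' Ek.
have [[nk qk] Ek'] : exists x, onth s k = Some x.
  by apply: onth_ex; have := onth_lt Ek; lia.
have sidek : side k.+1 = side i.
  rewrite /side Ek E'; case: (enab_side en) => // In.
  by rewrite (init_pos okX W Ek) in In.
have altk := side_alt evk Ek.
have sides b x t : onth s x = Some t -> side x = b -> exists y, sel b t.1 = Some y.
  case: t => a c Ex sx; have := keptE b Ex; rewrite sx eqxx /kept Ex.
  by case: (sel b a) => // y; exists y.
set b := side i in sidek altk alt.
have [y Ey] := sides b _ _ E' erefl; have [y' Ey'] := sides _ _ _ E alt; rewrite /= in Ey Ey'.
have [ev2] : ~~ odd i.+2 /\ i.+2 <= size s by rewrite /= negbK.
move=> le2; have [p1 R1 P1] := onth_even ev2 le2 (leqnSn _) E' Ey.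
have [p2 R2 P2] := onth_even ev2 le2 (ltnSn _) E Ey'.
have Ekn x : ~~ odd x -> x <= size s -> knt (~~ b) x = knt b x.
  by case: (b) => /= ? ?; rewrite knt_even.
have E12 : knt (~~ b) i.+1 = knt b i.
  rewrite kntS (keptE _ E') -/b Ekn //; last by lia.
  by case: (b); rewrite addn0.
(* Items [i] and [i.+1] occupy the same place of the common restriction, so they agree there in move
   and pointer. *)
rewrite E12 R1 in R2; case: R2 => Eyy Epp; subst y' p2.
have K1 : kept (fun _ => sel b) s k.+1 by rewrite (keptE _ Ek) sidek.
have K2 : kept (fun _ => sel (~~ b)) s k by rewrite (keptE _ Ek') -sidek altk negbK.
have [_ /(_ ltk)[/(_ K1) Ep1 _]] := P1.
have [_ [n1 [q1 [Ej enj]]]] := W _ _ _ E.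
(* A discarded justifier could only be the opening move, and then the restricted pointer would be
   absent, against [Ep1]. *)
have Kj : kept (fun _ => sel (~~ b)) s j.
  case: (boolP (kept _ s j)) => // NK; have [_ /(_ lej)[_ /(_ NK)]] := P2.
  rewrite Ep1.
  case: (enab_side enj) => [Es|In].
    move: NK; rewrite (keptE _ Ej) -alt {1}/side E /side Ej Es eqxx //.
  rewrite (init_pos okX W Ej) in In; move/eqP: In => j0.
  subst j; have Q := ptr0 W Ej; subst q1.
  by move=> /(_ _ Ej).
have [_ /(_ lej)[/(_ Kj)]] := P2.
rewrite Ep1 => -[Ec] _.
have Ejk : j = k.
  apply: (cnt_inj Kj K2); rewrite -Ec; rewrite -/(knt b _) -/(knt (~~ b) _).
  rewrite kntS (keptE _ Ek') Ekn //; last by have := onth_lt Ek'; lia.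
  by rewrite -sidek altk; case: (side k); rewrite addn0.
exists n, k, y; rewrite Ejk; split=> //.
by case: (b) Ey Ey' => /= -> ->; [right|left].
Qed.

(** From a copy, the P-view meets the copied move and jumps to the justifier of that move, a P-move
    directly after the justifier of the copy. So the copied move is the only O-move to compare, and
    it has the same level. *)
Lemma copycat_incr (lX : move X -> nat) (lY : move Y -> nat) :
  (forall m y, ~~ init m -> l m = Some y \/ r m = Some y -> lX m = lY y) ->
  incr lX s.
Proof.
move=> hL i m j k n q E P V ltjk En O.
have [[[W A] _ _] _ _] := cs.
have Par := parity okX (conj W A).
have lti := view_lt W V.
case: i E V lti => [//|i] E V lti.
have od : odd i.+1 by rewrite -(Par _ _ _ E).
have [i0|pos] := posnP i; first by lia.
have [n' [j' [y [[Ej] E' Lab]]]] := copycatP od pos E; subst j'.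
have Kn : k = i.
  have Oi : isP n' = false by rewrite (Par _ _ _ E'); apply/negbTE.
  case: (view_inv E' V) => [//|[]|[x [[Ex] _ V']]]; first by rewrite Oi.
  have ltk := view_lt W V'; have Ekj : k = j.+1 by lia.
  subst k; have [_ [a [b [Ea en]]]] := W _ _ _ E'.
  move: En; rewrite Ea => -[Ean _]; subst a.
  by have := enab_pol okX en; rewrite Oi (negbTE O).
subst k; move: En; rewrite E' => -[En _]; subst n'.
have nm : ~~ init m by rewrite (init_pos okX W E).
have nn : ~~ init n by rewrite (init_pos okX W E'); lia.
by case: Lab => -[L1 L2]; rewrite (hL m y) ?(hL n y); auto.
Qed.

End Copycat.

(** * Composition *)

Section Composition.
Variables (X Y Z : arena).
Hypotheses (okX : arena_ok X) (okY : arena_ok Y) (okZ : arena_ok Z).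
Variables (sigma : plays (arrow_arena X Y)) (tau : plays (arrow_arena Y Z)).
Variable u : pseq (move (arrow_arena (arrow_arena X Y) Z)).
Hypothesis Hu : interaction sigma tau u.

Let okXY := arrow_ok okX okY.
Let okYZ := arrow_ok okY okZ.
Let okXZ := arrow_ok okX okZ.
Let oku := arrow_ok okXY okZ.

Let sXY : pseq (move (arrow_arena X Y)) := restr (@on_XY X Y Z) u.
Let sYZ : pseq (move (arrow_arena Y Z)) := restr (@on_YZ X Y Z) u.
Let sXZ : pseq (move (arrow_arena X Z)) := restr (@on_XZ X Y Z) u.
Let kXY := kept (fun _ => @on_XY X Y Z) u.

Let root i := nth 0 (roots sXY) (cnt kXY i).

(* [None] is the environment, [Some None] the player of [tau] and [Some (Some b)]
   the player of [sigma] in its thread with root [b]. *)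
Let player := option (option nat).

Let K (c : player) : pred nat :=
  match c with
  | None => kept (fun _ => @on_XZ X Y Z) u
  | Some None => kept (fun _ => @on_YZ X Y Z) u
  | Some (Some b) => fun i => kXY i && (root i == b)
  end.

(** Every occurrence of [u] is seen by exactly two players, its maker and its receiver. The players
    of [tau] and [sigma] make the P-moves of their sequences; the environment makes the O-moves of
    [sXZ]. *)
Let mover i : player :=
  match onth u i with
  | Some (inl (inl x), _) => if isP x then None else Some (Some (root i))
  | Some (inl (inr y), _) => if isP y then Some (Some (root i)) else Some None
  | Some (inr z, _) => if isP z then Some None else None
  | None => None
  end.

Let recv i : player :=
  match onth u i with
  | Some (inl (inl x), _) => if isP x then Some (Some (root i)) else None
  | Some (inl (inr y), _) => if isP y then Some None else Some (Some (root i))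
  | Some (inr z, _) => if isP z then None else Some None
  | None => None
  end.

Let KE c i : i < size u -> K c i = (c == mover i) || (c == recv i).
Proof.
case/onth_ex=> -[m p] E; rewrite /mover /recv E.
case: c => [[b|]|]; rewrite /= /kXY /kept E.
- by case: m {E} => [[x|y]|z] /=; case: isP => //=; rewrite ?orbF /= eq_sym.
- by case: m {E} => [[x|y]|z] /=; case: isP.
- by case: m {E} => [[x|y]|z] /=; case: isP.
Qed.

Let mover_recv i : i < size u -> mover i != recv i.
Proof.
by case/onth_ex=> -[m p] E; rewrite /mover /recv E; case: m {E} => [[x|y]|z]; case: isP.
Qed.

Let Wu : well_pointed u. Proof. by case: Hu. Qed.

Let wp i m j : onth u i = Some (m, Some j) ->
  j < i /\ exists n q, onth u j = Some (n, q) /\ enab n m.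
Proof. by move/Wu. Qed.

Let tau_fact i m p : onth u i = Some (m, p) -> K (Some None) i ->
  exists y p', [/\ onth sYZ (cnt (K (Some None)) i) = Some (y, p'), on_YZ m = Some y,
    isP y = (mover i == Some None) &
    p' = None \/ exists j, [/\ p = Some j, K (Some None) j &
                               p' = Some (cnt (K (Some None)) j)]].
Proof.
move=> E /= Ki; case Ey: (on_YZ m) => [y|]; last by move: Ki; rewrite /kept E Ey.
have [p' E' [_ R]] := onth_restr (f := fun _ => @on_YZ X Y Z) E Ey.
exists y, p'; split=> //.
  by rewrite /mover E; case: m Ey {E Ki} => [[x|w]|z] // [<-] /=; case: isP.
case: p E R => [j|] E R; [|by left].
have [lt [n [q [En en]]]] := wp E; have [R1 R2] := R lt.
right; exists j; suff Kj : kept (fun _ => @on_YZ X Y Z) u j by rewrite R1.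
by rewrite /kept En; case: n m en Ey {En E Ki} => [[a|b]|c] [[a'|b']|c'].
Qed.

Let sXYP i m p y : onth u i = Some (m, p) -> on_XY m = Some y ->
  exists2 p', onth sXY (cnt kXY i) = Some (y, p')
    & restr_ptr (fun _ => @on_XY X Y Z) u i p p'.
Proof. exact: onth_restr. Qed.

Let sXY_back i m j : onth sXY i = Some (m, Some j) -> j < i.
Proof. by move=> E; have [? [? [? [_ _ <- [/(_ _ erefl)]]]]] := restr_surj E. Qed.

Let sig_thread i : kXY i -> sigma (thread (root i) sXY).
Proof.
move=> Ki; case: Hu => _ + _ _.
have lt : cnt kXY i < size sXY.
  by rewrite /sXY /restr size_restr; exact: cnt_lt (kept_lt Ki) Ki.
have [m Em] := root_pointerless lt sXY_back.
by apply; apply: Em.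
Qed.

Let inthr b (r : nat) (m : move (arrow_arena X Y)) :=
  if onth (roots sXY) r == Some b then Some m else None.

Let sig_kept b j : kXY j -> kept (inthr b) sXY (cnt kXY j) = (root j == b).
Proof.
move=> Kj; have := Kj; rewrite /kXY /kept; case E: (onth u j) => [[m p]|] //.
case Ey: (on_XY m) => [y|] // _; have [p' -> _] := sXYP E Ey.
rewrite /inthr onth_roots /root; first by case: eqP.
by rewrite /sXY /restr size_restr; exact: cnt_lt (kept_lt Kj) Kj.
Qed.

Let sig_cnt b n : cnt (K (Some (Some b))) n = cnt (kept (inthr b) sXY) (cnt kXY n).
Proof.
rewrite -cnt_comp; apply: eq_cnt => i _ /=.
by case Ki: (kXY i) => //=; rewrite sig_kept.
Qed.

Let sig_fact b i m p : (forall t, sigma t -> play t) ->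
  onth u i = Some (m, p) -> K (Some (Some b)) i ->
  exists y p', [/\ onth (thread b sXY) (cnt (K (Some (Some b))) i) = Some (y, p'),
    on_XY m = Some y,
    isP y = (mover i == Some (Some b)) &
    p' = None \/ exists j, [/\ p = Some j, K (Some (Some b)) j &
                               p' = Some (cnt (K (Some (Some b))) j)]].
Proof.
move=> Hs E /= /andP[Ki /eqP rb].
case Ey: (on_XY m) => [y|]; last by move: Ki; rewrite /kXY /kept E Ey.
have [p1 E1 [_ R1]] := sXYP E Ey.
have Hg := sig_kept b Ki; rewrite rb eqxx /kept E1 in Hg.
case Eg: (inthr b _ y) Hg => [y'|] // _.
have [p' E' [_ R']] := onth_restr (f := inthr b) E1 Eg.
have Eyy : y' = y by move: Eg; rewrite /inthr; case: ifP => // _ [].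
subst y'; rewrite -sig_cnt in E'.
exists y, p'; split=> //.
  rewrite /mover E; case: m Ey {E} => [[x|w]|z] // [<-] /=; case: isP => //=;
  by rewrite rb eqxx.
case: p E R1 => [j|] E R1; last by left; rewrite R1 in R'.
have [lt [n [q [En en]]]] := wp E; have [R1j _] := R1 lt.
(* A justifier outside [X] and [Y] belongs to [Z], so the move is initial in [Y]: it opens its
   thread and has no pointer there. *)
case Kj: (kXY j); last first.
  left; have [[W _] _ _] := Hs _ (sig_thread Ki); rewrite rb in W.
  have Iy : @init (arrow_arena X Y) y.
    move: Kj; rewrite /kXY /kept En.
    by case: n m en Ey {En E} => [[a|c]|d] [[a'|c']|d'] //= + [<-] //=;
      rewrite ?andbF //; case/andP.
  have := init_pos okXY W E'; rewrite Iy => /esym/eqP E0.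
  by rewrite E0 in E'; apply: ptr0 W E'.
right; exists j; have P1 := R1j Kj; subst p1.
have ltc : cnt kXY j < cnt kXY i by apply: cnt_lt.
have rj : root j = b.
  rewrite -rb /root (nth_roots E1) //; by move=> j' [<-].
have [R'j _] := R' ltc; split=> //; first by rewrite /= Kj rj eqxx.
by rewrite R'j ?sig_kept ?rj // -sig_cnt.
Qed.

(** * Incrementality of composites *)

Section Levels.
Variables (lX : move X -> nat) (lY : move Y -> nat) (lZ : move Z -> nat).
Let ulev := sum_lev (sum_lev lX lY) lZ.

Hypothesis Hs : forall t, sigma t ->
  play t /\ incr (sum_lev lX lY : move (arrow_arena X Y) -> nat) t.
Hypothesis Ht : forall t, tau t ->
  play t /\ incr (sum_lev lY lZ : move (arrow_arena Y Z) -> nat) t.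

(** Presents [tau] and every thread of [sigma] uniformly as an incremental play with a position
    translation, so that [segment] can treat an arbitrary player. *)
Let player_fact c i0 : c != None -> K c i0 ->
  exists (C : arena) (lv : move C -> nat) (s : pseq (move C)),
  [/\ arena_ok C, play s, incr lv s & forall i m p, onth u i = Some (m, p) -> K c i ->
  exists y p', [/\ onth s (cnt (K c) i) = Some (y, p'),
    isP y = (mover i == c), lv y = ulev m &
    p' = None \/ exists j, [/\ p = Some j, K c j & p' = Some (cnt (K c) j)]]].
Proof.
case: c => [[b|]|] // _ K0.
- have [Ki /eqP rb] := andP K0; have St := sig_thread Ki; rewrite rb in St.
  exists (arrow_arena X Y), (sum_lev lX lY), (thread b sXY).
  have [P I] := Hs St; split=> // i m p E Kb.
  have [|y [p' [? Em ? ?]]] := sig_fact _ E Kb; first by move=> t /Hs[].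
  by exists y, p'; split=> //; case: m Em {E} => [[?|?]|?] // [<-].
- have Tt : tau sYZ by case: Hu.
  exists (arrow_arena Y Z), (sum_lev lY lZ), sYZ.
  have [P I] := Ht Tt; split=> // i m p E Kb.
  have [y [p' [? Em ? ?]]] := tau_fact E Kb.
  by exists y, p'; split=> //; case: m Em {E} => [[?|?]|?] // [<-].
Qed.

Let play_XZ : @play (arrow_arena X Z) sXZ. Proof. by case: Hu. Qed.

(** Pointers are preserved for environment moves only: an initial move of [X] may be justified by a
    hidden move of [Y], but the environment does not make it. *)
Let env_fact i m p : onth u i = Some (m, p) -> K None i ->
  exists y p', [/\ onth sXZ (cnt (K None) i) = Some (y, p'), on_XZ m = Some y,
    isP y = (mover i != None) & [/\ sum_lev lX lZ y = ulev m,
    mover i = None -> p' = None \/ exists j, [/\ p = Some j, K None j &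
                               p' = Some (cnt (K None) j)] &
    restr_ptr (fun _ => @on_XZ X Y Z) u i p p']].
Proof.
move=> E /= Ki; case Ey: (on_XZ m) => [y|]; last by move: Ki; rewrite /kept E Ey.
have [p' E' R] := onth_restr (f := fun _ => @on_XZ X Y Z) E Ey.
exists y, p'; split=> //.
  by rewrite /mover E; case: m Ey {E Ki R} => [[x|w]|z] // [<-] /=; case: isP.
split=> //; first by case: m Ey {E Ki R} => [[x|w]|z] // [<-].
case: R => _; case: p E => [j|] E R; [|by left].
have [lt [n [q [En en]]]] := wp E; have [R1 R2] := R lt.
rewrite /mover E => Em.
right; exists j; suff Kj : kept (fun _ => @on_XZ X Y Z) u j by rewrite R1.
rewrite /kept En; case: n m en Ey Em {En E Ki} => [[a|b]|c] [[a'|b']|c'] //=.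
by case/andP=> _ /(init_O okX) ->.
Qed.

(** Meant as: [c] is to play after [n] moves. By alternation this is a parity, flipped for the
    environment, which plays the opening move. *)
Let tok c n := (c == None) (+) odd (cnt (K c) n).

Let tok_mover c i : i < size u -> K c i -> tok c i = (c == mover i).
Proof.
move=> lt Ki; have [[m p] E] := onth_ex lt; rewrite /tok.
case: (altP (c =P None)) => [c0|cN] /=.
  subst c; have [y [p' [E' _ P _]]] := env_fact E Ki.
  have [J _ _] := play_XZ; rewrite -(parity okXZ J E') P negbK; by rewrite eq_sym.
have [C [lv [s [okC [J _ _] _ /(_ _ _ _ E Ki)[y [p' [E' P _ _]]]]]]] := player_fact cN Ki.
by rewrite -(parity okC J E') P eq_sym.
Qed.

(** A move changes the parity of its maker and its receiver only, so the right to play passes from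
    the former to the latter. *)
Let token n c : n <= size u -> tok c n = (c == if n is n'.+1 then recv n' else None).
Proof.
elim: n c => [|n IH] c lt; first by rewrite /tok /= addbF.
have Em : mover n = if n is n'.+1 then recv n' else None.
  apply/eqP; rewrite -IH; last by lia.
  by rewrite tok_mover // KE ?eqxx.
have : tok c n.+1 = tok c n (+) K c n by rewrite /tok cntS oddD addbA oddb.
rewrite IH; last by lia.
rewrite -Em => ->; rewrite KE //; have := mover_recv lt.
case: (c =P mover n) => [->|_] /=; last by case: (c == recv n).
by move/negbTE->.
Qed.

Let switch n : n < size u -> mover n = if n is n'.+1 then recv n' else None.
Proof.
move=> lt; apply/eqP; rewrite -token; last exact: ltnW.
by rewrite tok_mover // KE ?eqxx.
Qed.

(* The trace of the P-view of [restr on_XZ u]: environment moves jump to their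
   justifiers, all other moves step back by one. *)
Inductive walk : nat -> nat -> Prop :=
| walk_refl p : walk p p
| walk_back p k : mover p.+1 != None -> walk p k -> walk p.+1 k
| walk_jump p m l k : mover p = None -> onth u p = Some (m, Some l) ->
    walk l k -> walk p k.

Let walk_le p k : walk p k -> k <= p.
Proof.
elim=> {p k} // [p k _ _|p m l k _ E _]; first by lia.
by have [lt _] := wp E; lia.
Qed.

Let walk_own p k : walk p k -> mover p != None -> k = p \/ walk p.-1 k.
Proof. by case=> {p k} [p _|p k _ V _|p m l k -> //]; [left|right]. Qed.

Let walk_env p k : walk p k -> mover p = None ->
  k = p \/ exists m l, onth u p = Some (m, Some l) /\ walk l k.
Proof.
case=> {p k} [p _|p k /eqP //|p m l k _ E V _]; first by left.
by right; exists m, l.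
Qed.

Let mover_pos i : mover i != None -> 0 < i < size u.
Proof.
case: (ltnP i (size u)) => [lt|ge]; last by rewrite /mover onth_default.
by case: i lt => // lt; rewrite switch.
Qed.

Let K_mover i : i < size u -> K (mover i) i. Proof. by move=> ?; rewrite KE ?eqxx. Qed.
Let K_recv i : i < size u -> K (recv i) i. Proof. by move=> ?; rewrite KE ?eqxx ?orbT. Qed.

(* The key invariant: all environment moves met by the trace strictly between
   a move and its justifier have at most its level.  An intermediate move in the
   shared arena closes a segment of the other player's view, to which the
   induction hypothesis applies. *)
Let segment i m j : onth u i = Some (m, Some j) -> mover i != None ->
  forall k n q, walk i.-1 k -> mover k = None -> onth u k = Some (n, q) ->
  ulev n <= ulev m \/ walk j k.
Proof.
elim/ltn_ind: i m j => i IHi m j E mi; set c := mover i in mi *.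
have [lti0 lti] := andP (mover_pos mi).
have Ki : K c i := K_mover lti.
have [C [lv [s [okC [[W A] V _] I F]]]] := player_fact mi Ki.
have [yi [pi [Ei Pi Li Hpi]]] := F _ _ _ E Ki; rewrite eqxx in Pi.
have [Kj Epi] : K c j /\ pi = Some (cnt (K c) j).
  case: Hpi => [pN|[_ [[<-]]] //]; subst pi.
  by have [_ /(init_O okC)] := W _ _ _ Ei; rewrite Pi.
subst pi; have {}V := V _ _ _ Ei; rewrite Pi in V.
have Oj : mover j != c.
  have [_ [n [q [Ej' ej]]]] := W _ _ _ Ei.
  have [_ [n' [q' [Ej _]]]] := wp E.
  have [y [p' [Ey Py _ _]]] := F _ _ _ Ej Kj; move: Ey; rewrite Ej' => -[En _]; subst y.
  by rewrite -Py; have := enab_pol okC ej; rewrite Pi; case: isP.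
(* Generalises from [i] to any move [n] of [c] met while descending the P-view of [c] from [i] to
   [j]; the second view hypothesis keeps the level bound on the O-moves still ahead. *)
suff G n : n <= i -> mover n = c -> view true s (cnt (K c) n) (cnt (K c) j) ->
   (forall o mo po, onth u o = Some (mo, po) -> K c o -> mover o != c ->
     view true s (cnt (K c) n) (cnt (K c) o) -> j < o -> ulev mo <= ulev m) ->
   forall k mk q, walk n.-1 k -> mover k = None -> onth u k = Some (mk, q) ->
     ulev mk <= ulev m \/ walk j k.
  move=> k mk q; apply: (G i) => // o mo po Eo Ko Oo Vo lto.
  have [yo [p' [Ey Py Ly _]]] := F _ _ _ Eo Ko.
  rewrite -Ly -Li; apply: (I _ _ _ _ _ _ Ei Pi Vo _ Ey); first exact: cnt_lt.
  by rewrite Py.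
elim/ltn_ind: n => n IHn len mn Vn B k mk q.
have ltn := leq_ltn_trans len lti.
have mn0 : mover n != None by rewrite mn.
have [n0 _] := andP (mover_pos mn0).
case: n IHn len mn Vn B ltn mn0 n0 => // o IHn len mn Vn B ltn mn0 _ /= Wk mk0 Ek.
have Ro : recv o = c by rewrite -mn switch.
have lto := ltnW ltn.
have Ko : K c o by rewrite -Ro K_recv.
have Mo : mover o != c by rewrite -Ro mover_recv.
have [[mo po] Eo] := onth_ex lto.
have [yo [p' [Ey Py Ly Hp]]] := F _ _ _ Eo Ko.
have Ec : cnt (K c) o.+1 = (cnt (K c) o).+1 by rewrite cntS Ko addn1.
have ltj : j < o.+1.
  by rewrite ltnNge; apply/negP=> /(cnt_mono (K c)); rewrite leqNgt (view_lt W Vn).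
have [jo|jo] := eqVneq o j; first by right; rewrite -jo.
have {}ltj : j < o by rewrite ltn_neqAle eq_sym jo -ltnS.
have Lo : ulev mo <= ulev m.
  apply: (B _ _ _ Eo Ko Mo) => //; rewrite Ec; apply: view_last; exact: onth_lt Ey.
(* [o] is received by [c] and differs from [j], so the view continues at its justifier [l], a move
   made by [c]. *)
have [l [El Kl Pl Vl]] : exists l, [/\ po = Some l, K c l,
    mover l = c & (forall r, view true s (cnt (K c) l) r -> view true s (cnt (K c) o.+1) r)
     /\ view true s (cnt (K c) l) (cnt (K c) j)].
  move: Vn; rewrite Ec => /(view_inv Ey)[/(cnt_inj Kj Ko) Ejo|[]|[l0 [El0 _ Vl]]].
  - by rewrite Ejo eqxx in jo.
  - by rewrite Py (negbTE Mo).
  case: Hp => [pN|[l [Ep Kl El]]]; first by rewrite pN in El0.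
  rewrite El in El0 Ey; case: El0 => El0; subst l0 po.
  have [_ [nl [ql [El' el]]]] := W _ _ _ Ey.
  have [_ [nl' [ql' [Eul _]]]] := wp Eo.
  have [yl [pl [Eyl Pyl _ _]]] := F _ _ _ Eul Kl.
  move: El'; rewrite Eyl => -[Eyy Eqq]; subst yl pl.
  have Pt : isP nl = true.
    by have := enab_pol okC el; rewrite Py (negbTE Mo); case: isP.
  have Ml : mover l = c by apply/eqP; rewrite -Pyl.
  exists l; split=> //; split.
    move=> r Vr; apply: (view_other Ey); first by rewrite Py (negbTE Mo).
    exact: view_own Eyl Pt Vr.
  case: (view_inv Eyl Vl) => [/(cnt_inj Kj Kl) Ejl|[] //|[? [_]]].
    by rewrite Ejl Ml eqxx in Oj.
  by rewrite Pt.
subst po; have [ltl _] := wp Eo; case: Vl => Vmono Vl.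
have rest : walk l k -> ulev mk <= ulev m \/ walk j k.
  move=> /walk_own; rewrite Pl => /(_ mi)[Ekl|Wl].
    by move: mi; rewrite -Pl -Ekl mk0.
  apply: (IHn l (ltnW ltl) (leq_trans (ltnW ltl) (ltnW len))) Wl mk0 Ek => //.
  by move=> o' mo' po' Eo' Ko' Oo' /Vmono Vo'; apply: B Eo' Ko' Oo' Vo'.
(* If the environment made [o], the trace ends there, where [Lo] applies, or jumps to [l]. Otherwise
   another player made [o], and the outer induction hypothesis covers the stretch between [l] and
   [o]. *)
have [mo0|mo0] := eqVneq (mover o) None.
  case: (walk_env Wk mo0) => [Eko|[m' [l' [El' Wl]]]].
    by left; move: Ek; rewrite Eko Eo => -[<- _].
  by move: El'; rewrite Eo => -[_ Ell]; apply: rest; rewrite Ell.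
case: (walk_own Wk mo0) => [Eko|Wl]; first by move: mo0; rewrite -Eko mk0.
case: (IHi o len _ _ Eo mo0 _ _ _ Wl mk0 Ek) => [le|]; last exact: rest.
by left; apply: leq_trans le Lo.
Qed.

(** Hidden moves and P-moves of [sXZ] are not made by the environment, so the trace steps back over
    them; an environment move keeps its justifier by [env_fact], so view and trace jump to the same
    place. *)
Let view_walk n r : n <= size u -> @view (arrow_arena X Z) true sXZ (cnt (K None) n) r ->
  exists k, [/\ K None k, cnt (K None) k = r, k < n & walk n.-1 k].
Proof.
have [[W A] _ _] := play_XZ.
elim/ltn_ind: n r => n IH r le.
case: n IH le => [|n] IH lt; first by move/(view_lt W).
have [[m p] E] := onth_ex lt; rewrite cntS.
case Kn: (K None n); last first.
  rewrite addn0 => V; have Mn : mover n != None.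
    by apply: contraFneq Kn => Mn; rewrite KE ?Mn.
  have [k [Kk Ek ltk Wk]] := IH _ (ltnSn _) r (ltnW lt) V.
  exists k; split=> //; first exact: leqW.
  by have [n0 _] := andP (mover_pos Mn);
    case: n n0 Mn Wk {IH lt E Kn V ltk} => // n _ Mn Wk; apply: walk_back.
rewrite addn1; have [y [p' [Ey _ Py [_ Hp _]]]] := env_fact E Kn.
move/(view_inv Ey)=> [->|[Pt V]|[l0 [El0 Pf V]]].
- by exists n; split=> //; apply: walk_refl.
- have Mn : mover n != None by rewrite -Py.
  have [k [Kk Ek ltk Wk]] := IH _ (ltnSn _) r (ltnW lt) V.
  exists k; split=> //; first exact: leqW.
  by have [n0 _] := andP (mover_pos Mn);
    case: n n0 Mn Wk {IH lt E Kn V ltk Ey Hp Py} => // n _ Mn Wk; apply: walk_back.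
- have Mn : mover n = None by apply/eqP; move: Pf; rewrite Py; case: eqP.
  case: (Hp Mn) => [pN|[l [Ep Kl El]]]; first by rewrite pN in El0.
  move: El0; rewrite El => -[El0]; subst l0 p.
  have [ltl _] := wp E.
  have := IH l.+1; rewrite cntS Kl addn1 ltnS => /(_ ltl r (ltn_trans ltl lt) V)[k [Kk Ek ltk Wk]].
  exists k; split=> //; first exact: leq_trans ltk (leqW ltl).
  exact: walk_jump Mn E Wk.
Qed.

(** The place where safety enters. In an application, threads of the argument satisfy the first
    alternative, its free variables having at least its order; threads of the function satisfy the
    second, as evaluation opens them at once. *)
Hypothesis Hinit : forall t y p x i p', sigma t -> onth t 0 = Some (inr y, p) ->
  onth t i = Some (inl x, p') -> init x ->
  lY y <= lX x \/
  forall t' k q, tau t' -> onth t' k = Some (inl y, q) -> k <= 1.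

(** [segment] gives the bound unless the trace passes through the justifier [j] in [u], which is
    impossible if [j] survives in [sXZ]. Otherwise [j] is an initial move of [Y] justifying an
    initial move of [X]; a second use of [segment], from [j] to the opening move, gives the level of
    [j] as bound, and [Hinit] compares it with that of the [X]-move. *)
Lemma interaction_incr : incr (sum_lev lX lZ : move (arrow_arena X Z) -> nat) sXZ.
Proof.
move=> i0 y j0 k0 y' q' Ei Pi V lt Ek Ok.
have [[W A] _ _] := play_XZ.
have [i [m [p [E Em Ec R]]]] := restr_surj Ei.
have Ki : K None i by rewrite /= /kept E Em.
have [yi [pi [Eyi Emi Pyi [Li _ [_ Ri]]]]] := env_fact E Ki.
move: Eyi; rewrite /= Ec -/sXZ Ei => -[? ?]; subst yi pi.
have Mi : mover i != None by rewrite -Pyi.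
have [i0' lti] := andP (mover_pos Mi).
rewrite -Ec in V.
have [k [Kk Ekc ltk Wk]] := view_walk (ltnW lti) V.
have [[mk pk] Euk] := onth_ex (ltn_trans ltk lti).
have [yk [p' [Eyk _ Pyk [Lk _ _]]]] := env_fact Euk Kk.
move: Eyk; rewrite Ekc Ek => -[? ?]; subst yk p'.
have Mk : mover k = None by apply/eqP; move: Ok; rewrite Pyk negbK.
rewrite Li Lk.
have [j Ep _] : exists2 j, p = Some j & j < i.
  case: i i0' E {Ki Ec R Mi lti V ltk Wk Ri Li Pyi} => // i _ E.
  by have [j] := ptrS Wu E; exists j.
subst p; case: (segment E Mi Wk Mk Euk) => [//|Wj].
have [ltj [n [q [Ej ej]]]] := wp E; have [Rk _] := Ri ltj.
case Kj: (K None j).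
  have [Ej0] := Rk Kj; have := cnt_mono (K None) (walk_le Wj); by rewrite Ekc -Ej0 leqNgt lt.
have [x [w [Enw Emx Iw Ix]]] : exists x w, [/\ n = inl (inr w), m = inl (inl x), init w & init x].
  move: Kj ej Em; rewrite /= /kept Ej; case: n m {Ej E Li Emi} => [[a|w]|z] [[x|w']|z'] //=.
  by move=> _ /andP[]; exists x, w.
subst n m.
have Mj : mover j = Some None by rewrite /mover Ej (init_O okY Iw).
have MjN : mover j != None by rewrite Mj.
have [j_pos ltj'] := andP (mover_pos MjN).
have k_pos : k != 0 by apply/eqP=> k00; move: Ekc lt; rewrite k00 /cnt /= => <-.
case: (walk_own Wj MjN) => [Ekj|Wj1]; first by rewrite -Ekj Mk in MjN.
have [j1 Eq] : exists j1, q = Some j1.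
  by case: j j_pos Ej {ltj Wj Rk Kj E Mj MjN ltj' Wj1 R Ri} => // j _ /(ptrS Wu)[j1]; exists j1.
subst q; have [_ [n1 [q1 [Ej1 ej1]]]] := wp Ej.
have j10 : j1 = 0.
  case: n1 Ej1 ej1 => [[a|w']|z] Ej1 //=.
    by move/(enab_init okY); rewrite Iw.
  by case/andP=> Iz _; have := init_pos oku Wu Ej1; rewrite /= Iz => /esym/eqP.
subst j1; case: (segment Ej MjN Wj1 Mk Euk) => [le|/walk_le]; last by rewrite leqn0 (negbTE k_pos).
apply: leq_trans le _ => /=.
have Mi' : mover i = Some (Some (root i)) by rewrite /mover E (init_O okX Ix).
have Kib : K (Some (Some (root i))) i by rewrite -Mi' K_mover.
have St : sigma (thread (root i) sXY) by apply: sig_thread; case/andP: Kib.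
have HsP t : sigma t -> play t by case/Hs.
have [a [pa [Ea Exa Pa Hpa]]] := sig_fact HsP E Kib.
have [[Ws _] _ _] := HsP _ St; rewrite Mi' eqxx in Pa.
have Kjb : K (Some (Some (root i))) j.
  case: Hpa => [paN|[? [[<-]]] //]; subst pa.
  by have [_ /(init_O okXY)] := Ws _ _ _ Ea; rewrite Pa.
have [a' [pa' [Ea' Exa' _ _]]] := sig_fact HsP Ej Kjb.
case: Exa Exa' => ? [?]; subst a a'.
have := init_pos okXY Ws Ea'; rewrite /= Iw => /esym/eqP E0.
rewrite [cnt _ j]E0 in Ea'.
case: (Hinit St Ea' Ea Ix) => [//|spec].
have Tt : tau sYZ by case: Hu.
have Kjt : K (Some None) j by rewrite -Mj K_mover.
have [a [pa'' [Eta Exta _ _]]] := tau_fact Ej Kjt; case: Exta => ?; subst a.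
have := spec _ _ _ Tt Eta.
(* If [j] is 1, the trace below it contains only 0. A later [j] has rank at least 2 in [sYZ], since
   [tau] sees the first two moves of [u], against the second alternative. *)
have [j_eq1|j_ne1] := eqVneq j 1.
  by move: Wj1; rewrite j_eq1 /= => /walk_le; rewrite leqn0 (negbTE k_pos).
have j2 : 2 <= j by rewrite ltn_neqAle eq_sym j_ne1.
have l0 : 0 < size u := leq_ltn_trans (leq0n _) ltj'.
have l1 : 1 < size u := leq_ltn_trans j_pos ltj'.
have R0 : recv 0 = Some None.
  have [[m0 p0] E00] := onth_ex l0; have Ep0 := ptr0 Wu E00; subst p0.
  have := init_pos oku Wu E00; rewrite /recv E00; case: (m0) => [//|z] /= Iz.
  by rewrite (init_O okZ) ?Iz.
have K0 : K (Some None) 0 by rewrite -R0 K_recv.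
have K1 : K (Some None) 1.
  by have := switch l1; rewrite R0 => <-; rewrite K_mover.
by have := cnt_mono (K (Some None)) j2; rewrite !cntS K0 K1 => le2 /(leq_trans le2).
Qed.

End Levels.

(** Carries information on free variables through an application. *)
Lemma interaction_left (P : move X -> Prop) :
  (forall t, sigma t -> play t) ->
  (forall t i x p, sigma t -> onth t i = Some (inl x, p) -> P x) ->
  forall i x p, onth sXZ i = Some (inl x, p) -> P x.
Proof.
move=> Hs H i x p Ex; have [k [m [q [E Em _ _]]]] := restr_surj Ex.
have Em' : m = inl (inl x) by case: m Em {E} => [[?|?]|?] //= [->].
subst m; have Kk : kXY k by rewrite /kXY /kept E.
have Kb : K (Some (Some (root k))) k by rewrite /= Kk eqxx.
have [y [p' [Ey [?] _ _]]] := sig_fact Hs E Kb.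
by subst y; apply: H Ey; apply: sig_thread Kk.
Qed.

End Composition.

(** * Free variables and safety *)

Definition up_pred G A (P : forall B, var G B -> Prop) B (x : var (A :: G) B) : Prop :=
  match x in var G' B0
    return (if G' is _ :: G0 then (forall B, var G0 B -> Prop) -> Prop else unit)
  with
  | vz _ _ => fun _ => True
  | vs _ _ _ y => fun P' => P' _ y
  end P.

Fixpoint fv_all G A (M : tm G A) : (forall B, var G B -> Prop) -> Prop :=
  match M in tm G A return (forall B, var G B -> Prop) -> Prop with
  | Var _ _ x => fun P => P _ x
  | App _ _ _ M1 M2 => fun P => fv_all M1 P /\ fv_all M2 P
  | Lam _ _ _ M1 => fun P => fv_all M1 (up_pred P)
  end.

(* The only trace of safety needed by the semantics, and one stable under
   renaming: arguments have no free variables of order below their own. *)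
Fixpoint safe_args G A (M : tm G A) : Prop :=
  match M with
  | Var _ _ _ => True
  | App G A _ M1 M2 =>
      [/\ safe_args M1, safe_args M2 & fv_all M2 (fun B _ => ord A <= ord B)]
  | Lam _ _ _ M1 => safe_args M1
  end.

Lemma var_ind_cons G A (Q : forall B, var (A :: G) B -> Prop) :
  Q A vz -> (forall B (y : var G B), Q B (vs y)) -> forall B (x : var (A :: G) B), Q B x.
Proof.
move=> Qz Qs B x.
refine (match x in var G' B' return
  (match G' return var G' B' -> Prop with
   | [::] => fun _ => True
   | A' :: G0 => fun x => forall Q : forall B, var (A' :: G0) B -> Prop,
       Q A' vz -> (forall B (y : var G0 B), Q B (vs y)) -> Q B' x
   end x) with vz _ _ => _ | vs _ _ _ y => _ end Q Qz Qs); by move=> Q' Qz' Qs'; try exact: Qs'.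
Qed.

Lemma fv_all_sub G A (M : tm G A) (P Q : forall B, var G B -> Prop) :
  (forall B x, P B x -> Q B x) -> fv_all M P -> fv_all M Q.
Proof.
elim: M P Q => [{A}G A x|{A}G A B M1 IH1 M2 IH2|{A}G A B M IH] P Q PQ /=.
- exact: PQ.
- by case=> /(IH1 _ _ PQ) ? /(IH2 _ _ PQ).
- by apply: IH; apply: (var_ind_cons (Q := fun C x => up_pred P x -> up_pred Q x)) => //=.
Qed.

Lemma fv_allT G A (M : tm G A) (P : forall B, var G B -> Prop) :
  (forall B x, P B x) -> fv_all M P.
Proof.
elim: M P => [{A}G A x|{A}G A B M1 IH1 M2 IH2|{A}G A B M IH] P HP //=.
- by split; [apply: IH1|apply: IH2].
- by apply: IH; apply: (var_ind_cons (Q := fun C x => up_pred P x)) => //= C y; apply: HP.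
Qed.

Lemma fv_all_rename G A (M : tm G A) D (r : ren G D) (P : forall B, var D B -> Prop) :
  fv_all M (fun B x => P B (r B x)) -> fv_all (rename M r) P.
Proof.
elim: M D r P => [{A}G A x|{A}G A B M1 IH1 M2 IH2|{A}G A B M IH] D r P //=.
- by case=> /IH1 ? /IH2.
- move=> H; apply: IH; apply: fv_all_sub H.
  exact: (var_ind_cons (Q := fun C x => _ -> up_pred P (ren_up r x))).
Qed.

Lemma safe_args_rename G A (M : tm G A) D (r : ren G D) :
  safe_args M -> safe_args (rename M r).
Proof.
elim: M D r => [{A}G A x|{A}G A B M1 IH1 M2 IH2|{A}G A B M IH] D r //=; last exact: IH.
by case=> ? ? F; split; [apply: IH1|apply: IH2|apply: fv_all_rename].
Qed.

Lemma safe_args_lams As G B (M : tm (catrev As G) B) :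
  safe_args M -> safe_args (lams M).
Proof. by elim: As G M => //= A As IH G M; apply: IH. Qed.

Lemma ord_le_ctxP c G : ord_le_ctx c G -> forall B, var G B -> c <= ord B.
Proof. by move=> + B x; elim: x => [G' A|G' A C x IH] /= /andP[] // _ /IH. Qed.

Scheme safe_mind := Minimality for safe Sort Prop
  with asa_mind := Minimality for asa Sort Prop.

(** The second component comes from the side conditions of application and abstraction, which bound
    the whole context, and survives weakening since it concerns free variables only. It fails in
    general for [asa], whose induction carries the first alone. *)
Lemma safe_safe_args G A (M : tm G A) : safe M ->
  safe_args M /\ fv_all M (fun B _ => ord A <= ord B).
Proof.
move: G A M.
apply: (safe_mind (P := fun G A M => safe_args M /\ fv_all M (fun B _ => ord A <= ord B))
  (P0 := fun G A M => safe_args M)) => //=.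
- move=> G D A M r _ _ [? ?].
  by split; [apply: safe_args_rename|apply: fv_all_rename].
- move=> G A B M N _ sM _ [sN fN] /ord_le_ctxP H; split=> //.
  by split; apply: fv_allT.
- move=> G As B M _ _ sM /ord_le_ctxP H; split; first exact: safe_args_lams.
  exact: fv_allT.
- by move=> G A M _ [].
- by move=> G A B M N _ sM _ [sN fN].
Qed.

(** * Denotations are incremental *)

Section Denotations.
Variable D : Type.

Lemma var_move_lev G A (x : var G A) m (a : move (ty_arena D A)) :
  var_move x m = Some a -> clev m = lev a /\ init m = init a.
Proof.
by elim: x m a => [G' A'|G' A' B x IH] [g|b] a //=; [move=> [<-]|move/IH].
Qed.

Lemma var_move_enab G A (x : var G A) (m n : move (ctx_arena D G)) :
  enab m n -> var_move x m = var_move x n :> bool.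
Proof. by elim: x m n => [G' A'|G' A' B x IH] [g|b] [g'|b'] //=; apply: IH. Qed.

Lemma curry_play (X Y Z : arena) (t : pseq (move (arrow_arena (prod_arena X Y) Z))) :
  play t -> @play (arrow_arena X (arrow_arena Y Z)) (relabel (@curry_move X Y Z) t).
Proof.
apply: (@play_relabel (arrow_arena (prod_arena X Y) Z) (arrow_arena X (arrow_arena Y Z))).
- by case=> [[x|y]|z].
- by case=> [[x|y]|z].
- by case=> [[x|y]|z].
- by move=> [[x|y]|z] [[x'|y']|z'].
Qed.

Lemma pair_l_play (X Y Z : arena) (t : pseq (move (arrow_arena X Y))) :
  play t -> @play (arrow_arena X (prod_arena Y Z)) (relabel (@pair_l X Y Z) t).
Proof.
apply: (@play_relabel (arrow_arena X Y) (arrow_arena X (prod_arena Y Z))).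
- by case.
- by case.
- by case.
- by move=> [x|y] [x'|y'].
Qed.

Lemma pair_r_play (X Y Z : arena) (t : pseq (move (arrow_arena X Z))) :
  play t -> @play (arrow_arena X (prod_arena Y Z)) (relabel (@pair_r X Y Z) t).
Proof.
apply: (@play_relabel (arrow_arena X Z) (arrow_arena X (prod_arena Y Z))).
- by case.
- by case.
- by case.
- by move=> [x|y] [x'|y'].
Qed.

Lemma den_play G A (M : tm G A) t : den D M t -> play t.
Proof.
elim: M t => [{A}G A x|{A}G A B M1 IH1 M2 IH2|{A}G A B M IH] t /=.
- by case.
- by case=> u [_ _ _ P] ->.
- by case=> t' /IH P ->; apply: curry_play.
Qed.

Lemma pairing_play G A B (M : tm G A) (N : tm G B) t :
  pairing (den D M) (den D N) t -> play t.
Proof.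
by case=> -[t' /den_play P ->]; [apply: pair_l_play|apply: pair_r_play].
Qed.

(** Links syntax to plays: moves on the context side belong to free variables. For an abstraction,
    currying has moved the component of the bound variable to the right, so a left move cannot
    belong to it. *)
Lemma den_left G A (M : tm G A) (P : forall B, var G B -> Prop) : fv_all M P ->
  forall t i g p, den D M t -> onth t i = Some (inl g, p) ->
  exists B (x : var G B), var_move x g /\ P B x.
Proof.
elim: M P => [{A}G A x|{A}G A B M1 IH1 M2 IH2|{A}G A B M IH] P /=.
- move=> Px t i g p [_ /(all_nthP (inl g, p)) H _] E.
  by exists A, x; have := H _ (onth_lt E); rewrite (onth_nth _ _ _ _ E) /= orbF.
- case=> F1 F2 t i g p [u Hu ->] E.
  apply: (interaction_left (P := fun g => exists B (x : var G B), var_move x g /\ P B x)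
            (ctx_ok D G) (prod_ok (ty_ok D (Arr A B)) (ty_ok D A)) Hu _ _ E).
    exact: pairing_play.
  move=> {E Hu u}t j x q [] [t' Ht' ->] Ex; have [[x'|?] E' //= [?]] := relabel_inv Ex; subst x'.
    exact: (IH1 _ F1 _ _ _ _ Ht' E').
  exact: (IH2 _ F2 _ _ _ _ Ht' E').
- move=> F t i g p [t' Ht' ->] Eg; have [[[g'|a]|b] E //= [?]] := relabel_inv Eg; subst g'.
  have [C [x]] := IH _ F _ _ _ _ Ht' E.
  move: C x; apply: (var_ind_cons (Q := fun C x => var_move x (inl g : move (ctx_arena D (A :: G)))
    /\ up_pred P x -> _)) => [[]|C y [Ey Py]] //.
  by exists C, y.
Qed.

Definition den_lev G A : move (arrow_arena (ctx_arena D G) (ty_arena D A)) -> nat :=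
  sum_lev (@clev D G) (@lev D A).

Lemma proj_incr G A (x : var G A) t : @proj D G A x t -> incr (@den_lev G A) t.
Proof.
have ok := arrow_ok (ctx_ok D G) (ty_ok D A).
move=> Ht; apply: (copycat_incr ok _ _ Ht (lY := @lev D A)).
- by case.
- move=> [g|a] [g'|a'] //=; last by auto.
  + by move/(var_move_enab x)->; left.
  + by case/andP; right.
- move=> [g|a] y _ /= [] //; first by case/var_move_lev.
  by case=> ->.
Qed.

Section Eval.
Variables A B : ty.
Let TA := ty_arena D A.
Let TB := ty_arena D B.
Let TAB := ty_arena D (Arr A B).
Let ev : plays (arrow_arena (prod_arena TAB TA) TB) := @eval TA TB.
Let okE := arrow_ok (prod_ok (ty_ok D (Arr A B)) (ty_ok D A)) (ty_ok D B).

Let disj (m : move (arrow_arena (prod_arena TAB TA) TB)) :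
  eval_l m -> eval_r m -> False.
Proof. by case: m => [[]|]. Qed.

Let enab_side (m n : move (arrow_arena (prod_arena TAB TA) TB)) : enab m n ->
  eval_l m = eval_l n :> bool \/ init m.
Proof.
by case: m n => [[m|a]|b] [[m'|a']|b'] //=; auto; case/andP; auto.
Qed.

Lemma eval_incr t : ev t ->
  incr (sum_lev (sum_lev (@lev D (Arr A B)) (@lev D A)) (@lev D B)
        : move (arrow_arena (prod_arena TAB TA) TB) -> nat) t.
Proof.
move=> Ht; apply: (@copycat_incr (arrow_arena (prod_arena TAB TA) TB) TAB (@eval_l TA TB)
  (@eval_r TA TB) okE disj enab_side t Ht _ (@lev D (Arr A B))).
move=> [[m|a]|b] y /= nI [] // [<-] //=.
by rewrite (negbTE nI).
Qed.

(** Past position 1 such a move would copy an initial move of the right-hand side that is not at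
    position 0. *)
Lemma eval_init t k (m : move TAB) q : ev t -> init m ->
  onth t k = Some (inl (inl m), q) -> k <= 1.
Proof.
move=> Ht Im E; have [[[W A'] _ _] _ _] := Ht.
have odk : odd k.
  rewrite -(parity okE (conj W A') E) /=.
  by have := init_O (ty_ok D (Arr A B)) Im; rewrite /= => ->.
case: k odk E => [|[|k]] // odk E.
have [n [j [y [_ En [[/= [Ey]]|[]] //]]]]  :=
  @copycatP (arrow_arena (prod_arena TAB TA) TB) TAB (@eval_l TA TB) (@eval_r TA TB)
    okE disj enab_side t Ht _ _ _ odk isT E.
subst y; case: m Im {E} => // b Ib; case: n En => [[?|?]|b'] En // [Eb]; subst b'.
by have := init_pos okE W En; rewrite /= => E0; rewrite /= E0 in Ib.
Qed.

End Eval.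

Lemma den_incr G A (M : tm G A) t : safe_args M -> den D M t -> incr (@den_lev G A) t.
Proof.
elim: M t => [{A}G A x|{A}G A B M1 IH1 M2 IH2|{A}G A B M IH] t /=.
- by move=> _; apply: proj_incr.
- case=> s1 s2 F [u Hu ->].
  pose lY : move (prod_arena (ty_arena D (Arr A B)) (ty_arena D A)) -> nat :=
    sum_lev (@lev D (Arr A B)) (@lev D A).
  apply: (interaction_incr (ctx_ok D G) (prod_ok (ty_ok D (Arr A B)) (ty_ok D A))
    (ty_ok D B) Hu (lY := lY)).
  + move=> {u Hu}t Ht; split; first exact: (pairing_play (M := M1) (N := M2) Ht).
    case: Ht => -[t' Ht' ->].
      apply: (incr_relabel (lX := @den_lev G (Arr A B)) _ (arrow_ok (ctx_ok D G) (ty_ok D (Arr A B)))).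
      * by case.
      * by case.
      * exact: den_play Ht'.
      * exact: IH1 Ht'.
    apply: (incr_relabel (lX := @den_lev G A) _ (arrow_ok (ctx_ok D G) (ty_ok D A))).
    * by case.
    * by case.
    * exact: den_play Ht'.
    * exact: IH2 Ht'.
  + by move=> {u Hu}t Ht; split; [case: Ht|apply: eval_incr].
  + move=> {u Hu}t y p x i p' [] [t' Ht' ->] Ey Ex Ix;
      have [[?|m] E0 //= [->]] := relabel_inv Ey;
      have [[x'|?] Ei //= [?]] := relabel_inv Ex; subst x'.
      (* Function thread: evaluation can open it only with its first move. *)
      right=> t1 k q Ht1 Ek; apply: eval_init Ht1 _ Ek.
      have [[W _] _ _] := den_play Ht'.
      by have := init_pos (arrow_ok (ctx_ok D G) (ty_ok D (Arr A B))) W E0.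
    (* Argument thread: by safety the variable played has at least the order of the argument, so its
       initial question has at least the level of the thread's opening. *)
    left; have [[W _] _ _] := den_play Ht'.
    have := init_pos (arrow_ok (ctx_ok D G) (ty_ok D A)) W E0; rewrite /= => Im.
    rewrite (lev_init Im); have [C [v [Ev leC]]] := den_left F Ht' Ei.
    case Ev': (var_move v x) Ev => [a|] // _.
    by have [-> Ia] := var_move_lev Ev'; rewrite lev_init // -Ia.
- move=> sM [t' Ht' ->].
  apply: (incr_relabel (lX := @den_lev (A :: G) B) _ (arrow_ok (ctx_ok D (A :: G)) (ty_ok D B))).
  + by case=> [[x|y]|z].
  + by move=> [[x|y]|z] //= /negbTE ->.
  + exact: den_play Ht'.
  + exact: IH Ht'.
Qed.

Lemma den_lev_enab G A (m n : move (arrow_arena (ctx_arena D G) (ty_arena D A))) :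
  enab m n -> ~~ init m -> den_lev n < den_lev m.
Proof.
case: m n => [g|a] [g'|a'] //=.
- by move/clev_enab.
- by case/andP=> ->.
- by move/lev_enab.
Qed.

Lemma close_moveP G T (m : move (ctx_arena D G) + move (ty_arena D T)) :
  isP (close_move m) = @isP (arrow_arena (ctx_arena D G) (ty_arena D T)) m.
Proof.
elim: G T m => [|A G IH] T m /=; first by case: m => [[]|].
by rewrite IH; case: m => [[g|a]|b].
Qed.

Lemma close_move_inj G T : injective (@close_move D G T).
Proof.
elim: G T => [|A G IH] T /=; first by move=> [[]|a] [[]|b] // ->.
by move=> m n /IH; case: m n => [[g|a]|b] [[g'|a']|b'] //= [->].
Qed.

(** Transfers the hypothesis of the theorem to the arena with the context on the left, where
    incrementality is established. *)
Lemma erase_P_close G T (s t : pseq (move (arrow_arena (ctx_arena D G) (ty_arena D T)))) :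
  erase_P (relabel (@close_move D G T) s) = erase_P (relabel (@close_move D G T) t) ->
  erase_P s = erase_P t.
Proof.
elim: s t => [|[m p] s IH] [|[n q] t] //= [/close_move_inj -> + /IH ->].
by rewrite !close_moveP => ->.
Qed.

End Denotations.

Theorem proposition4p12 (D : Type) (D_nonempty : inhabited D)
    (G : ctx) (T : ty) (M : tm G T) :
  safe M ->
  forall s t : pseq (move (ty_arena D (close G T))),
    sem D M s -> sem D M t -> erase_P s = erase_P t -> s = t.
Proof.
move=> /safe_safe_args[sM _] _ _ [s Hs ->] [t Ht ->] /erase_P_close E; congr relabel.
apply: (incr_inj (arrow_ok (ctx_ok D G) (ty_ok D T)) (@den_lev_enab D G T)) E.
- exact: den_play Hs.
- exact: den_play Ht.
- exact: den_incr Hs.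
- exact: den_incr Ht.
Qed.
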